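(* Let $X$ and $Y$ be represented spaces, let $A\subseteq\mathbb{N}^{\mathbb{N}}$, and let $f:\subseteq X\rightrightarrows Y$ be a multi-valued function. Then the following are equivalent: (1) $f\leq_{\mathrm W}\mathsf{C}_A$; (2) $f$ is non-deterministically computable with advice space $A$.
   Context: Baire space is $\mathbb{N}^{\mathbb{N}}$, with its usual product topology and a fixed computable bijective pairing $\langle\cdot,\cdot\rangle$ on it. Computability of partial functions $F:\subseteq\mathbb{N}^{\mathbb{N}}\to\mathbb{N}^{\mathbb{N}}$ is meant via (type-2) Turing machines. A representation of a set $X$ is a surjective partial function $\delta:\subseteq\mathbb{N}^{\mathbb{N}}\to X$; $(X,\delta)$ is a represented space. $f:\subseteq X\rightrightarrows Y$ denotes a partial multi-valued function ($f(x)\neq\emptyset$ for $x\in\mathrm{dom}(f)$). A realizer of $f:\subseteq(X,\delta_X)\rightrightarrows(Y,\delta_Y)$, written $F\vdash f$, is a single-valued $F:\subseteq\mathbb{N}^{\mathbb{N}}\to\mathbb{N}^{\mathbb{N}}$ with $\delta_Y F(p)\in f\delta_X(p)$ for all $p\in\mathrm{dom}(f\delta_X)$. Weihrauch reducibility $f\leq_{\mathrm W}g$ means: there are computable $K,H:\subseteq\mathbb{N}^{\mathbb{N}}\to\mathbb{N}^{\mathbb{N}}$ such that the function $p\mapsto K\langle p,GH(p)\rangle$ is a realizer of $f$ for every $G\vdash g$. Sierpiński space $\mathbb{S}=\{0,1\}$ has topology $\{\emptyset,\{1\},\{0,1\}\}$ and representation $\delta_{\mathbb{S}}(p)=1\iff(\exists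 n)\,p(n)=0$. For a represented space $(X,\delta)$, a set $U\subseteq X$ is open if its characteristic function $\chi_U:X\to\mathbb{S}$ has a continuous realizer, and closed sets are the complements of open sets. $\mathcal{A}_-(X)$ is the set of closed subsets of $X$ with the representation $\psi_-^X$: a name of $A$ is a name of $\chi_{X\setminus A}$ in the canonical function space representation $[\delta\to\delta_{\mathbb{S}}]$ (a name $nq$, $n\in\mathbb N$, $q\in\mathbb{N}^{\mathbb{N}}$, names $\chi$ iff $r\mapsto\Phi_n\langle q,r\rangle$ is a realizer of $\chi$, where $\Phi_n$ is the $n$-th computable partial function on $\mathbb{N}^{\mathbb{N}}$). Closed choice is $\mathsf{C}_X:\subseteq\mathcal{A}_-(X)\rightrightarrows X,\ A\mapsto A$ with domain the non-empty closed sets (any point of $A$ is an admissible output). A subset $A\subseteq\mathbb{N}^{\mathbb{N}}$ is regarded as a represented space via the restriction of the identity. Non-deterministic computability: for represented spaces $(X,\delta_X),(Y,\delta_Y)$ and $A\subseteq\mathbb{N}^{\mathbb{N}}$, a function $f:\subseteq X\rightrightarrows Y$ is non-deterministically computable with advice space $A$ if there are computable $F_1,F_2:\subseteq\mathbb{N}^{\mathbb{N}}\to\mathbb{N}^{\mathbb{N}}$ such that $\langle\mathrm{dom}(f\delta_X)\times A\rangle\subseteq\mathrm{dom}(F_2)$ and for each $p\in\mathrm{dom}(f\delta_X)$: (i) $(\exists r\in A)\ \delta_{\mathbb{S}}F_2\langle p,r\rangle=0$; (ii) $(\forall r\in A)\ (\delta_{\mathbb{S}}F_2\langle p,r\rangle=0\Rightarrow\delta_YF_1\langle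 p,r\rangle\in f\delta_X(p))$. *)

(* Defs.v *)
From mathcomp Require Import all_boot all_classical topology.

Set Implicit Arguments.
Unset Strict Implicit.
Unset Printing Implicit Defensive.

Local Open Scope classical_set_scope.
Local Open Scope nat_scope.

(* Partial functions are option-valued, multi-valued functions f : X => Y are
   set-valued maps [f : X -> set Y] with domain {x | f x nonempty}. *)

Definition pdom (S T : Type) (F : S -> option T) : set S :=
  [set x | isSome (F x)].

Definition mdom (S T : Type) (f : S -> set T) : set S := [set x | f x !=set0].

(* The element of P, when there is one.  It is only used for sets P with at
   most one element (see outputs_unique and closed_name_unique). *)
Definition the (T : Type) (P : set T) : option T :=
  if pselect (exists x, P x) is left h then Some (projT1 (cid h)) else None.

(* ** Baire space *)

(* The canonical topology on nat is discrete. *)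
Definition baire := prod_topology (fun _ : nat => nat).

Definition bpair (p q : baire) : baire :=
  fun n => if odd n then q n./2 else p n./2.

Definition bfst (p : baire) : baire := fun n => p n.*2.
Definition bsnd (p : baire) : baire := fun n => p n.*2.+1.

Lemma bpairK p q : bfst (bpair p q) = p /\ bsnd (bpair p q) = q.
Proof.
split; apply/funext => n; rewrite /bfst /bsnd /bpair /= odd_double ?doubleK //=.
by rewrite uphalf_double.
Qed.

Lemma bpair_surj p : bpair (bfst p) (bsnd p) = p.
Proof.
apply/funext => n; rewrite /bpair /bfst /bsnd -[in RHS](odd_double_half n).
by case: (odd n).
Qed.

Definition btail (p : baire) : baire := fun n => p n.+1.

(* ** Type-2 Turing machines *)

(* A machine has a one-way read-only input tape, a one-way write-only output
   tape, both over {0,1}, and finitely many two-way infinite work tapes.  It is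
   given by a flowchart, i.e. a finite list of instructions; its control states
   are the positions in that list.  Work tape symbols are numbers, 0 being the
   blank; a program mentions, hence uses, only finitely many symbols and
   tapes. *)
Inductive instr :=
| MoveLeft of nat                (* move the head of work tape t *)
| MoveRight of nat
| Write of nat & nat             (* Write t a: write a on work tape t *)
| IfWork of nat & nat & nat      (* IfWork t a j: if work tape t shows a, goto j *)
| MoveInput                      (* advance the input head *)
| IfInput of nat                 (* IfInput j: if the input head reads 1, goto j *)
| Output of bool                 (* append a symbol to the output tape *)
| Halt.

Definition program := seq instr.

(* (l, r) is a tape whose head scans the first symbol of r, with l the part to
   the left of the head, nearest symbol first; the rest is blank. *)
Definition wtape := (seq nat * seq nat)%type.
Definition scan (w : wtape) : nat := head 0 w.2.
Definition write (a : nat) (w : wtape) : wtape := (w.1, a :: behead w.2).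
Definition move_left (w : wtape) : wtape := (behead w.1, head 0 w.1 :: w.2).
Definition move_right (w : wtape) : wtape := (scan w :: w.1, behead w.2).
Definition blank : wtape := ([::], [::]).

Record config := Config {
  state : nat;
  inpos : nat;          (* position of the input head *)
  work : seq wtape;     (* tapes beyond the list are blank *)
  out : seq bool        (* output so far, in the order of writing *)
}.

Definition update (t : nat) (g : wtape -> wtape) (ws : seq wtape) : seq wtape :=
  set_nth blank ws t (g (nth blank ws t)).

Definition step (M : program) (x : nat -> bool) (c : config) : config :=
  let: Config s i ws o := c in
  match nth Halt M s with
  | MoveLeft t => Config s.+1 i (update t move_left ws) o
  | MoveRight t => Config s.+1 i (update t move_right ws) o
  | Write t a => Config s.+1 i (update t (write a) ws) o
  | IfWork t a j =>
      Config (if scan (nth blank ws t) == a then j else s.+1) i ws o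
  | MoveInput => Config s.+1 i.+1 ws o
  | IfInput j => Config (if x i then j else s.+1) i ws o
  | Output b => Config s.+1 i ws (rcons o b)
  | Halt => c
  end.

Definition run (M : program) (x : nat -> bool) (n : nat) : config :=
  iter n (step M x) (Config 0 0 [::] [::]).

(* The inscription 1^(p 0) 0 1^(p 1) 0 1^(p 2) 0 ... of p on a tape. *)
Definition blocks (p : baire) (n : nat) : seq bool :=
  flatten [seq rcons (nseq (p i) true) false | i <- iota 0 n].
Definition inscription (p : baire) (k : nat) : bool :=
  nth false (blocks p k.+1) k.

Definition outputs (M : program) (p q : baire) : Prop :=
  forall n, exists t,
    take n (out (run M (inscription p) t)) = mkseq (inscription q) n.

(* The domain of the function computed by M consists of all p for which the
   infinite output is the inscription of some q. *)
Definition machine_fun (M : program) (p : baire) : option baire :=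
  the (outputs M p).

Definition computable (F : baire -> option baire) : Prop :=
  exists M : program, F = machine_fun M.

(* Goedel numbering, by means of the bijection CodeSeq.decode from nat to
   seq nat. *)
Definition decode_instr (c : seq nat) : instr :=
  match c with
  | [:: 0; t] => MoveLeft t
  | [:: 1; t] => MoveRight t
  | [:: 2; t; a] => Write t a
  | [:: 3; t; a; j] => IfWork t a j
  | [:: 4] => MoveInput
  | [:: 5; j] => IfInput j
  | [:: 6; b] => Output (b != 0)
  | _ => Halt
  end.

Definition program_of (n : nat) : program :=
  [seq decode_instr (CodeSeq.decode m) | m <- CodeSeq.decode n].

Definition Phi (n : nat) : baire -> option baire := machine_fun (program_of n).

Definition encode_instr (i : instr) : seq nat :=
  match i with
  | MoveLeft t => [:: 0; t]
  | MoveRight t => [:: 1; t]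
  | Write t a => [:: 2; t; a]
  | IfWork t a j => [:: 3; t; a; j]
  | MoveInput => [:: 4]
  | IfInput j => [:: 5; j]
  | Output b => [:: 6; nat_of_bool b]
  | Halt => [::]
  end.

Lemma program_of_surj (M : program) : exists n, program_of n = M.
Proof.
exists (CodeSeq.code [seq CodeSeq.code (encode_instr i) | i <- M]).
rewrite /program_of CodeSeq.codeK -map_comp -[RHS]map_id; apply: eq_map => i /=.
by rewrite CodeSeq.codeK; case: i => //; case.
Qed.

Lemma blocksS p n : blocks p n.+1 = blocks p n ++ rcons (nseq (p n) true) false.
Proof. by rewrite /blocks -addn1 iotaD map_cat flatten_cat /= cats0 add0n. Qed.

Lemma size_blocks p n : n <= size (blocks p n).
Proof.
elim: n => // n IH; rewrite blocksS size_cat size_rcons addnS ltnS.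
exact: leq_trans IH (leq_addr _ _).
Qed.

Lemma nth_blocks p n m k : k < size (blocks p n) -> n <= m ->
  nth false (blocks p m) k = nth false (blocks p n) k.
Proof.
move=> kn; elim: m => [|m IH]; first by rewrite leqn0 => /eqP ->.
rewrite leq_eqVlt => /predU1P[-> //|nm]; rewrite blocksS nth_cat.
rewrite -(IH nm); case: ifP => // /negbT; rewrite -leqNgt => km.
rewrite [in RHS]nth_default // ; exfalso.
have : size (blocks p n) <= size (blocks p m).
  rewrite -(subnK (nm : n <= m)); elim: (m - n) => // d IHd.
  by rewrite addSn blocksS size_cat (leq_trans IHd) ?leq_addr.
by move/(leq_trans kn); rewrite ltnNge km.
Qed.

Lemma inscription_blocks p n k : k < size (blocks p n) ->
  inscription p k = nth false (blocks p n) k.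
Proof.
move=> kn; rewrite /inscription; case: (leqP n k.+1) => [nk|/ltnW kn'].
  exact: nth_blocks.
by symmetry; apply: nth_blocks => //; exact: size_blocks.
Qed.

Lemma inscription_inj : injective inscription.
Proof.
move=> p q epq.
have key (p1 q1 : baire) n : inscription p1 = inscription q1 ->
    blocks p1 n = blocks q1 n -> q1 n <= p1 n.
  move=> e en; rewrite leqNgt; apply/negP => pq.
  have hp : inscription p1 (size (blocks p1 n) + p1 n) = false.
    rewrite (@inscription_blocks _ n.+1); last first.
      by rewrite blocksS size_cat size_rcons size_nseq addnS.
    rewrite blocksS nth_cat ltnNge leq_addr /= addKn nth_rcons size_nseq.
    by rewrite ltnn eqxx.
  move: hp; rewrite e en (@inscription_blocks _ n.+1); last first.
    by rewrite blocksS size_cat size_rcons size_nseq addnS ltnS leq_add2l ltnW.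
  rewrite blocksS nth_cat ltnNge leq_addr /= addKn nth_rcons size_nseq pq.
  by rewrite nth_nseq pq.
have bl n : blocks p n = blocks q n.
  elim: n => // n IH; rewrite !blocksS IH; congr (_ ++ rcons (nseq _ _) _).
  by apply/eqP; rewrite eqn_leq !key.
by apply/funext => n; apply/eqP; rewrite eqn_leq !key.
Qed.

Lemma out_prefix M x t t' : t <= t' -> prefix (out (run M x t)) (out (run M x t')).
Proof.
move=> /subnK <-; elim: (t' - t) => [|d IH]; first exact: prefix_refl.
apply: prefix_trans IH _; rewrite addSn /run iterS -/(run M x (d + t)).
case: (run M x (d + t)) => s i ws o /=.
by case: (nth Halt M s) => * /=; rewrite ?prefix_refl ?prefix_rcons.
Qed.

Lemma outputs_unique M p q q' : outputs M p q -> outputs M p q' -> q = q'.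
Proof.
move=> hq hq'; apply: inscription_inj; apply/funext => k.
have [t et] := hq k.+1; have [t' et'] := hq' k.+1.
wlog tt' : q q' t t' hq hq' et et' / t <= t'.
  by move=> W; case/orP: (leq_total t t') => ?; [|symmetry]; apply: W; eauto.
have /prefixP[s es] := out_prefix M (inscription p) tt'.
have sz : k.+1 <= size (out (run M (inscription p) t)).
  by move/(congr1 size): et; rewrite size_mkseq size_take_min => <-; exact: geq_minr.
move: et'; rewrite es takel_cat // et => /(congr1 (nth false ^~ k)).
by rewrite !nth_mkseq.
Qed.

(* ** Represented spaces *)

(* namedSpace drops the surjectivity of the naming map; the space of closed
   sets below is introduced at this level. *)
Record namedSpace := NamedSpace {
  carrier :> Type;
  delta : baire -> option carrier
}.

Record repSpace := RepSpace {
  named :> namedSpace;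
  delta_surj : forall x : named, exists p, delta named p = Some x
}.

(* F |- f; names of points outside the domain of f are unconstrained. *)
Definition realizes (X Y : namedSpace) (F : baire -> option baire)
    (f : X -> set Y) : Prop :=
  forall p x, delta X p = Some x -> mdom f x ->
    exists q y, [/\ F p = Some q, delta Y q = Some y & f x y].

Definition weihrauch_le (X Y Z W : namedSpace) (f : X -> set Y)
    (g : Z -> set W) : Prop :=
  exists K H : baire -> option baire,
    [/\ computable K, computable H &
      forall G, realizes G g ->
        realizes (fun p => obind (fun h => obind (fun q => K (bpair p q)) (G h))
                                 (H p)) f].

Definition single (X Y : Type) (g : X -> Y) (x : X) : set Y := [set g x].

(* ** Sierpinski space, closed sets and closed choice *)

Definition deltaS (p : baire) : bool := `[< exists n, p n = 0 >].

Definition sierpinski : namedSpace :=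
  @NamedSpace bool (fun p => Some (deltaS p)).

Definition chi (X : namedSpace) (U : set X) : X -> sierpinski :=
  fun x => `[< U x >].

Definition pcontinuous (F : baire -> option baire) : Prop :=
  {within pdom F, continuous (fun p => odflt (fun=> 0 : nat) (F p) : baire)}.

Definition open_in (X : namedSpace) (U : set X) : Prop :=
  exists F, pcontinuous F /\ realizes F (single (chi U)).

Definition closed_in (X : namedSpace) (B : set X) : Prop := open_in (~` B).

(* p = nq is a name of g in the function space representation. *)
Definition function_name (X Y : namedSpace) (p : baire) (g : X -> Y) : Prop :=
  realizes (fun r => Phi (p 0) (bpair (btail p) r)) (single g).

Definition closed_name (X : namedSpace) (p : baire)
    (B : {B : set X | closed_in B}) : Prop :=
  function_name p (chi (~` (sval B))).

Lemma closed_name_unique (X : repSpace) p (B B' : {B : set X | closed_in B}) :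
  closed_name p B -> closed_name p B' -> B = B'.
Proof.
case: B => B cB; case: B' => B' cB'; rewrite /closed_name /= => h h'.
apply: eq_exist; apply/funext => x; apply/propext.
have [r rx] := delta_surj x.
have dom C : mdom (single (chi (~` C))) x by exists (chi (~` C) x).
have [q [_ [Fq [<-]]]] := h r x rx (dom B).
have [q' [_ [Fq' [<-]]]] := h' r x rx (dom B').
move: Fq'; rewrite Fq => -[<-] /=; rewrite /single /chi /= => ->.
move=> /(congr1 is_true); rewrite !asboolE => E.
by split=> b; apply: contrapT => n; [have : ~ B x by rewrite -E
  | have : ~ B' x by rewrite E].
Qed.

(* A_-(X) with the representation psi_-. *)
Definition closed_sets (X : repSpace) : namedSpace :=
  @NamedSpace {B : set X | closed_in B} (fun p => the (@closed_name X p)).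

Definition closed_choice (X : repSpace) : closed_sets X -> set X :=
  fun B => sval B.

(* A subset of Baire space, represented by the restriction of the identity. *)
Definition subspace_named (A : set baire) : namedSpace :=
  @NamedSpace (set_type A) (fun p => insub p).

Lemma subspace_surj A (x : subspace_named A) :
  exists p, delta (subspace_named A) p = Some x.
Proof. by exists (val x); rewrite /= valK. Qed.

Definition subspace_rep (A : set baire) : repSpace := RepSpace (@subspace_surj A).

(* ** Non-deterministic computability *)

Definition nondet_computable (A : set baire) (X Y : namedSpace)
    (f : X -> set Y) : Prop :=
  exists F1 F2 : baire -> option baire,
    [/\ computable F1, computable F2 &
      forall p x, delta X p = Some x -> mdom f x ->
        [/\ forall r, A r -> pdom F2 (bpair p r),
            exists r s,
              [/\ A r, F2 (bpair p r) = Some s & deltaS s = false] &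
            forall r s, A r -> F2 (bpair p r) = Some s -> deltaS s = false ->
              exists q y,
                [/\ F1 (bpair p r) = Some q, delta Y q = Some y & f x y]]].

(* Main.v *)
Require Import Defs.
From mathcomp Require Import all_boot all_classical topology.
From mathcomp Require Import zify.

Set Implicit Arguments.
Unset Strict Implicit.
Unset Printing Implicit Defensive.

Local Open Scope nat_scope.

(** From non-deterministic computations to reductions. Given [F1] and [F2] with
advice space [A], the advice accepted for an input named [p] forms the set of
all [r] in [A] on which [F2 <p, r>] names 0. It is nonempty by the first
condition. It is closed, because a computable function is continuous on its
domain ([machine_fun_local], [pcontinuous_local]), and a name of it is just [n]
followed by [p], where [n] is an index of [F2]. So [H p = np] and [K = F1]
reduce [f] to closed choice ([nondet_weihrauch]).

From reductions to non-deterministic computations. Given [K] and [H], the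
function [F1 = K] turns correct advice into results: every point of the closed
set named by [H p] is the answer of some realizer of closed choice
([weihrauch_nondet]). The function [F2] has to recognize incorrect advice, that
is, to semidecide that the sequence named by [H p] maps [r] outside of the
closed set: if [H p = nq], then [Phi n <q, r>] has a zero. The index [n] varies
with [p], so this needs a universal machine, and most of the text builds one.

The universal machine comes in two layers. The search layer is one machine
([search_machine]) that reads its input bit by bit, evaluates a decidable
property [P] of the prefix read so far, writes 1 as long as [P] fails and 0
forever once it holds. Its output is total, and it names the point 1 of
Sierpinski space if and only if [P] holds for some prefix. The property used
here is that simulating [H] and then [Phi n], for as many steps as the prefix
allows, produces a zero ([simulated_value]). It holds for some prefix if and
only if the true value has a zero, since the simulated output on longer and
longer prefixes converges to the true one ([tends_value]).

The second layer shows that [P] is decidable by a flowchart machine. Programs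
with registers and bounded loops are compiled to flowcharts, with registers held
in unary on work tapes ([run_compile]). The functions on numbers that they
compute are closed under composition, pairing and iteration ([loopable]). Finite
data are coded by numbers through an iterated pairing function, and the
functions that loop programs compute on codes ([effective]) include the usual
list operations, the step function of a machine whose program is part of the
data ([eff_step]) and the decoding of programs ([eff_program_of]). *)

(** * Loop programs and their execution by machines *)

(** Every loop program terminates, so its semantics is a total function and the
correctness of its compilation is a statement about reachability alone. The two
infinite loops that are needed, in [search_code] and in [computable_bcons], are
written directly as flowcharts. *)
Inductive loop :=
| Inc of nat
| Clear of nat
| Seq of loop & loop
| Loop of nat & loop.

Definition upd (s : nat -> nat) (r v : nat) : nat -> nat :=
  fun i => if i == r then v else s i.

Fixpoint sem (c : loop) (s : nat -> nat) : nat -> nat :=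
  match c with
  | Inc r => upd s r (s r).+1
  | Clear r => upd s r 0
  | Seq c1 c2 => sem c2 (sem c1 s)
  | Loop r c => iter (s r) (sem c) s
  end.

Definition reach M x (c c' : config) := exists n, iter n (step M x) c = c'.

Lemma reach_refl M x c : reach M x c c.
Proof. by exists 0. Qed.

Lemma reach_trans M x c c' c'' :
  reach M x c c' -> reach M x c' c'' -> reach M x c c''.
Proof. by move=> [n <-] [m <-]; exists (m + n); rewrite iterD. Qed.

Lemma reach_step M x c c' : reach M x (step M x c) c' -> reach M x c c'.
Proof. by move=> [n <-]; exists n.+1; rewrite iterSr. Qed.

Definition code_at (M : program) (b : nat) (p : program) : Prop :=
  forall k, k < size p -> nth Halt M (b + k) = nth Halt p k.

Lemma code_at_cat M b p q :
  code_at M b (p ++ q) -> code_at M b p /\ code_at M (b + size p) q.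
Proof.
move=> h; split=> k hk; last first.
  by rewrite -addnA h ?size_cat ?ltn_add2l // nth_cat ltnNge leq_addr /= addKn.
by rewrite h ?size_cat ?ltn_addr // nth_cat hk.
Qed.

(** A tape at rest has [k = 0]: the head is on the blank to the right of [n]
marks. Positive values of [k] occur while the head is travelling across the
marks. Speaking of entries only makes trailing blanks irrelevant. *)
Definition unary (n k : nat) (w : wtape) : Prop :=
  forall i, nth 0 w.1 i = (i < n) /\ nth 0 w.2 i = (i < k).

Lemma unary_blank : unary 0 0 blank.
Proof. by move=> i; rewrite !nth_nil. Qed.

Lemma unary_scan n k w : unary n k w -> scan w = (0 < k).
Proof. by move=> /(_ 0)[_]; rewrite nth0. Qed.

Lemma unary_inc n w : unary n 0 w -> unary n.+1 0 (move_right (write 1 w)).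
Proof.
move=> h [|i]; split=> //=; rewrite ?nth_behead; try by case: (h i).
  by case: (h 1).
by case: (h i.+2).
Qed.

Lemma unary_dec n w : unary n.+1 0 w -> unary n 0 (write 0 (move_left w)).
Proof.
move=> h i; split=> /=; first by rewrite nth_behead; case: (h i.+1).
by case: i => [//|i] /=; case: (h i).
Qed.

Lemma unary_left n k w : unary n.+1 k w -> unary n k.+1 (move_left w).
Proof.
move=> h i; split=> /=; first by rewrite nth_behead; case: (h i.+1).
case: i => [|i] /=; first by rewrite -nth0; case: (h 0).
by case: (h i).
Qed.

Lemma unary_left0 w : unary 0 0 w -> unary 0 0 (move_left w).
Proof.
move=> h i; split=> /=; first by rewrite nth_behead; case: (h i.+1).
by case: i => [|i] /=; rewrite -?nth0; case: (h 0) => // _ _; case: (h i).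
Qed.

Lemma unary_right n k w : unary n k.+1 w -> unary n.+1 k (move_right w).
Proof.
move=> h i; split=> /=; last by rewrite nth_behead; case: (h i.+1).
case: i => [|i] /=; first by rewrite /scan -nth0; case: (h 0).
by case: (h i).
Qed.

(** Stepping beyond the left end of the marks and back, as happens when a sweep
to the left discovers that there are no more marks. *)
Lemma unary_bounce k w : unary 0 k w -> unary 0 k (move_right (move_left w)).
Proof.
move=> h i; split=> /=; last by case: (h i).
case: i => [|i] /=; rewrite ?nth_behead; last by case: (h i.+1).
by rewrite /scan /= -nth0; case: (h 0).
Qed.

Lemma scan_left0 k w : unary 0 k w -> scan (move_left w) = 0.
Proof. by move=> h; rewrite /scan /= -nth0; case: (h 0). Qed.

Definition holds (s : nat -> nat) (ws : seq wtape) : Prop :=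
  forall t, unary (s t) 0 (nth blank ws t).

Lemma nth_update t g ws u :
  nth blank (update t g ws) u =
  if u == t then g (nth blank ws t) else nth blank ws u.
Proof. by rewrite /update nth_set_nth /=; case: eqP => // ->. Qed.

Lemma holds_update s t v g ws :
    holds s ws -> unary v 0 (g (nth blank ws t)) ->
  holds (upd s t v) (update t g ws).
Proof.
by move=> h hg u; rewrite nth_update /upd; case: eqP => // _; exact: h.
Qed.

Lemma updE s r v : upd s r v r = v.
Proof. by rewrite /upd eqxx. Qed.

Lemma upd_upd s r v v' : upd (upd s r v) r v' = upd s r v'.
Proof. by apply/funext => i; rewrite /upd; case: eqP. Qed.

Lemma upd_id s r : upd s r (s r) = s.
Proof. by apply/funext => i; rewrite /upd; case: eqP => // ->. Qed.

Definition inc_code (t : nat) : program := [:: Write t 1; MoveRight t].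

Definition dec_code (t e : nat) : program :=
  [:: MoveLeft t; IfWork t 0 e; Write t 0].

Definition goto (b : nat) : program := [:: IfWork 0 0 b].

Definition clear_code (t b : nat) : program := dec_code t (b + 4) ++ goto b.

Definition copy_code (t d b : nat) : program :=
  [:: MoveLeft t; IfWork t 0 (b + 5); Write d 1; MoveRight d; IfWork 0 0 b;
      MoveRight t; IfWork t 1 (b + 5)].

(** Register [r] lives on tape [2r+1], and a loop at nesting depth [d] counts
down on tape [2d]. All tapes are at rest between commands and show a blank then,
so testing tape 0 for a blank is an unconditional jump. *)
Fixpoint compile (c : loop) (d b : nat) : program :=
  match c with
  | Inc r => inc_code r.*2.+1
  | Clear r => clear_code r.*2.+1 b
  | Seq c1 c2 =>
      let p := compile c1 d b in p ++ compile c2 d (b + size p)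
  | Loop r c =>
      let p := compile c d.+1 (b + 10) in
      copy_code r.*2.+1 d.*2 b ++ dec_code d.*2 (b + 11 + size p) ++
      p ++ goto (b + 7)
  end.

Section Execution.
Variables (M : program) (x : nat -> bool) (i : nat) (o : seq bool).

Lemma reach_instr s ws c' (I : instr) : nth Halt M s = I ->
  (reach M x match I with
  | MoveLeft t => Config s.+1 i (update t move_left ws) o
  | MoveRight t => Config s.+1 i (update t move_right ws) o
  | Write t a => Config s.+1 i (update t (write a) ws) o
  | IfWork t a j =>
      Config (if scan (nth blank ws t) == a then j else s.+1) i ws o
  | MoveInput => Config s.+1 i.+1 ws o
  | IfInput j => Config (if x i then j else s.+1) i ws o
  | Output b => Config s.+1 i ws (rcons o b)
  | Halt => Config s i ws o
  end c') -> reach M x (Config s i ws o) c'.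
Proof. by move=> e h; apply: reach_step => /=; rewrite e. Qed.

Lemma run_goto b e s ws c : code_at M b (goto e) -> holds s ws ->
  reach M x (Config e i ws o) c -> reach M x (Config b i ws o) c.
Proof.
move=> hM hs h; apply: reach_instr.
  by rewrite -[b]addn0; apply: (hM 0).
by rewrite /= (unary_scan (hs 0)).
Qed.

Lemma run_inc t b s ws : code_at M b (inc_code t) -> holds s ws ->
  exists ws', holds (upd s t (s t).+1) ws' /\
    reach M x (Config b i ws o) (Config (b + 2) i ws' o).
Proof.
move=> hM hs; have e k (kp : k < 2) := hM k kp.
exists (update t move_right (update t (write 1) ws)); split.
  move=> u; rewrite !nth_update eqxx /upd; case: eqP => [_|_]; last exact: hs.
  by apply: unary_inc; exact: hs.
apply: reach_instr; first by rewrite -[b]addn0; apply: (e 0).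
apply: reach_instr; first by rewrite -addn1; apply: (e 1).
by rewrite addn2; exact: reach_refl.
Qed.

Lemma run_dec t b e s ws : code_at M b (dec_code t e) -> holds s ws ->
  exists ws', holds (upd s t (s t).-1) ws' /\
    reach M x (Config b i ws o)
      (Config (if s t == 0 then e else b + 3) i ws' o).
Proof.
move=> hM hs; have E k (kp : k < 3) := hM k kp.
have hst := hs t.
have [s0|s0] := eqVneq (s t) 0.
  rewrite s0 in hst *; exists (update t move_left ws); split.
    by apply: holds_update => //; exact: unary_left0.
  apply: reach_instr; first by rewrite -[b]addn0; apply: (E 0).
  apply: reach_instr; first by rewrite -addn1; apply: (E 1).
  by rewrite /= nth_update eqxx (scan_left0 hst); exact: reach_refl.
case: (s t) s0 hst => // n _ hst.
exists (update t (write 0) (update t move_left ws)); split.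
  move=> u; rewrite !nth_update eqxx /upd; case: eqP => [_|_]; last exact: hs.
  exact: unary_dec.
apply: reach_instr; first by rewrite -[b]addn0; apply: (E 0).
apply: reach_instr; first by rewrite -addn1; apply: (E 1).
rewrite /= nth_update eqxx (unary_scan (unary_left hst)) /=.
apply: reach_instr; first by rewrite -addn2; apply: (E 2).
by rewrite addn3; exact: reach_refl.
Qed.

Lemma run_clear t b s ws : code_at M b (clear_code t b) -> holds s ws ->
  exists ws', holds (upd s t 0) ws' /\
    reach M x (Config b i ws o) (Config (b + 4) i ws' o).
Proof.
move=> hM hs; have [h1 h2] := code_at_cat hM.
move: {2}(s t) (erefl (s t)) => n.
elim: n s ws hs => [|n IH] s ws hs st.
  have [ws' [hs']] := run_dec h1 hs.
  by rewrite st => h; exists ws'; rewrite st in hs'.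
have [ws1 [hs1]] := run_dec h1 hs; rewrite st /= => r1.
have [|ws2 [hs2 r2]] := IH _ _ hs1; first by rewrite updE st.
exists ws2; split; first by rewrite upd_upd in hs2.
by apply: reach_trans r1 _; apply: run_goto h2 hs1 r2.
Qed.

(** Scanning tape [t] to its left end and back leaves it intact, which is what
makes copying it non-destructive. *)
Lemma run_copy t d b s ws : code_at M b (copy_code t d b) -> holds s ws ->
  s d = 0 -> t != 0 -> t != d ->
  exists ws', holds (upd s d (s t)) ws' /\
    reach M x (Config b i ws o) (Config (b + 7) i ws' o).
Proof.
move=> hM hs sd t0 td; have E k (kp : k < 7) := hM k kp.
(* On the way: [a] marks left of the head of tape [t], [m] marks from the head
   on, and [v] marks copied to tape [d] so far. *)
pose inv a m v ws1 := unary a m (nth blank ws1 t) /\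
  forall u : nat, u != t -> unary (upd s d v u) 0 (nth blank ws1 u).
have left_sweep a : forall m ws1, inv a m m ws1 -> exists ws2,
    inv 0 (a + m) (a + m) ws2 /\ reach M x (Config b i ws1 o)
      (Config (b + 5) i (update t move_left ws2) o).
  elim: a => [|a IH] m ws1 [h1 h2].
    exists ws1; split=> //.
    apply: reach_instr; first by rewrite -[b]addn0; apply: (E 0).
    apply: reach_instr; first by rewrite -addn1; apply: (E 1).
    by rewrite /= nth_update eqxx (scan_left0 h1); exact: reach_refl.
  pose ws1' :=
    update d move_right (update d (write 1) (update t move_left ws1)).
  have inv1 : inv a m.+1 m.+1 ws1'.
    split=> [|u ut]; rewrite !nth_update.
      by rewrite (negbTE td) eqxx; exact: unary_left.
    rewrite eqxx /upd; have [_|ud] := eqVneq u d; last first.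
      by rewrite (negbTE ut); have := h2 u ut; rewrite /upd (negbTE ud).
    rewrite [d == t]eq_sym (negbTE td); apply: unary_inc.
    by have := h2 d; rewrite eq_sym td updE; exact.
  have [ws2 [h3 r3]] := IH _ _ inv1.
  exists ws2; split; first by rewrite addSnnS.
  apply: reach_instr; first by rewrite -[b]addn0; apply: (E 0).
  apply: reach_instr; first by rewrite -addn1; apply: (E 1).
  rewrite /= nth_update eqxx (unary_scan (unary_left h1)) /=.
  apply: reach_instr; first by rewrite -addn2; apply: (E 2).
  apply: reach_instr; first by rewrite -addn3; apply: (E 3).
  apply: reach_instr; first by rewrite -addn4; apply: (E 4).
  by have := inv1.2 0; rewrite eq_sym => /(_ t0) /unary_scan /= ->.
have right_sweep k v : forall a ws1, inv a k v (update t move_right ws1) ->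
    exists ws2, inv (a + k) 0 v ws2 /\
      reach M x (Config (b + 5) i ws1 o) (Config (b + 7) i ws2 o).
  elim: k => [|k IH] a ws1 h.
    exists (update t move_right ws1); split; first by rewrite addn0.
    apply: reach_instr; first by apply: (E 5).
    apply: reach_instr; first by rewrite -addnS; apply: (E 6).
    by rewrite /= (unary_scan h.1) -!addnS; exact: reach_refl.
  have [|ws2 [h3 r3]] := IH a.+1 (update t move_right ws1).
    split=> [|u ut]; last by rewrite nth_update (negbTE ut); exact: h.2.
    by rewrite nth_update eqxx; apply: unary_right; exact: h.1.
  exists ws2; split; first by rewrite addnS.
  apply: reach_instr; first by apply: (E 5).
  apply: reach_instr; first by rewrite -addnS; apply: (E 6).
  by rewrite /= (unary_scan h.1).
have [|ws1 [h1 r1]] := left_sweep (s t) 0 ws.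
  by split=> [|u ut]; [exact: hs|have -> : upd s d 0 = s by rewrite -sd upd_id].
rewrite addn0 in h1.
have [|ws2 [h2 r2]] := right_sweep (s t) (s t) 0 (update t move_left ws1).
  split=> [|u ut]; rewrite !nth_update ?eqxx.
    by apply: unary_bounce; exact: h1.1.
  by rewrite (negbTE ut); exact: h1.2.
exists ws2; split; last exact: reach_trans r1 r2.
move=> u; have [->|ut] := eqVneq u t; last exact: h2.2.
by rewrite /upd (negbTE td); exact: h2.1.
Qed.

(** Loop variables and registers are kept apart by the parity of the tape. *)
Definition tapes (s e : nat -> nat) : nat -> nat :=
  fun t => if odd t then s t./2 else e t./2.

Lemma tapes_reg s e r : tapes s e r.*2.+1 = s r.
Proof. by rewrite /tapes /= odd_double /= uphalf_double. Qed.

Lemma tapes_ctr s e d : tapes s e d.*2 = e d.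
Proof. by rewrite /tapes /= odd_double /= doubleK. Qed.

Lemma tapes_upd_reg s e r v : upd (tapes s e) r.*2.+1 v = tapes (upd s r v) e.
Proof.
apply/funext => t; rewrite /upd /tapes.
have [->|ne] := eqVneq t r.*2.+1.
  by rewrite /= odd_double /= uphalf_double eqxx.
case: ifP => // ot; case: eqP => // e1; case/eqP: ne.
by rewrite -[t]odd_double_half ot e1.
Qed.

Lemma tapes_upd_ctr s e d v : upd (tapes s e) d.*2 v = tapes s (upd e d v).
Proof.
apply/funext => t; rewrite /upd /tapes.
have [->|ne] := eqVneq t d.*2; first by rewrite /= odd_double /= doubleK eqxx.
case: ifP => // ot; case: eqP => // e1; case/eqP: ne.
by rewrite -[t]odd_double_half ot e1.
Qed.

(** The counters from depth [d] on have to be free, because the copying at the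
start of a loop adds its marks to those already on the counter tape. *)
Lemma run_compile c : forall d b s e ws, code_at M b (compile c d b) ->
    holds (tapes s e) ws -> (forall j, d <= j -> e j = 0) ->
  exists ws', holds (tapes (sem c s) e) ws' /\
    reach M x (Config b i ws o) (Config (b + size (compile c d b)) i ws' o).
Proof.
elim: c => [r|r|c1 IH1 c2 IH2|r c IH] d b s e ws hM hs he.
- by have := run_inc hM hs; rewrite tapes_upd_reg tapes_reg.
- by have := run_clear hM hs; rewrite tapes_upd_reg.
- have [hM1 hM2] := code_at_cat hM.
  have [ws1 [hs1 r1]] := IH1 _ _ _ _ _ hM1 hs he.
  have [ws2 [hs2 r2]] := IH2 _ _ _ _ _ hM2 hs1 he.
  by exists ws2; split=> //=; rewrite size_cat addnA; apply: reach_trans r1 r2.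
pose whole p := copy_code r.*2.+1 d.*2 b ++
  dec_code d.*2 (b + 11 + size p) ++ p ++ goto (b + 7).
have eL : compile (Loop r c) d b = whole (compile c d.+1 (b + 10)) by [].
move: hM (IH d.+1 (b + 10)); rewrite {}eL {IH}.
move: (compile c d.+1 (b + 10)) => p; rewrite {}/whole => hM IH.
have /code_at_cat[hM1 /code_at_cat[hM2 /code_at_cat[hM3 hM4]]] := hM.
have -> : size (copy_code r.*2.+1 d.*2 b ++ dec_code d.*2 (b + 11 + size p) ++
    p ++ goto (b + 7)) = 11 + size p by rewrite !size_cat /= addn1.
move: hM2 hM3 hM4; rewrite [size (copy_code _ _ _)]/=.
rewrite [size (dec_code _ _)]/= -!addnA => hM2 hM3 hM4.
have [] := run_copy hM1 hs.
- by rewrite tapes_ctr he.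
- by [].
- by apply/eqP => /(congr1 odd); rewrite /= !odd_double.
rewrite tapes_reg tapes_upd_ctr => ws1 [hs1 r1].
(* The induction is on the number of rounds left, as shown by the counter. *)
suff loop k : forall s1 ws1, holds (tapes s1 (upd e d k)) ws1 ->
    exists ws', holds (tapes (iter k (sem c) s1) e) ws' /\
      reach M x (Config (b + 7) i ws1 o) (Config (b + (11 + size p)) i ws' o).
  have [ws2 [hs2 r2]] := loop _ _ _ hs1.
  by exists ws2; split=> //; apply: reach_trans r1 r2.
elim: k => [|k IHk] s1 ws2 hs2; have := run_dec hM2 hs2;
    rewrite tapes_ctr updE tapes_upd_ctr upd_upd => -[ws3 [hs3 r3]].
  exists ws3; split=> //.
  by have <- : upd e d 0 = e by rewrite -(he d (leqnn d)) upd_id.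
have [|ws4 [hs4 r4]] := IH _ _ _ hM3 hs3.
  by move=> j dj; rewrite /upd gtn_eqF // he // ltnW.
have [ws5 [hs5 r5]] := IHk _ _ hs4.
exists ws5; split; first by rewrite iterSr.
move: r3 r4; rewrite /= -!addnA => r3 r4.
apply: reach_trans r3 _; apply: reach_trans r4 _.
by apply: run_goto r5; last exact: hs4.
Qed.

End Execution.

(** * Functions computed by loop programs *)

(** In-place computation at an arbitrary register [n]: everything above [n] is
scratch space, everything below is preserved. This stack discipline is what
makes the class closed under composition, pairing and iteration. *)
Definition loopable (f : nat -> nat) : Prop :=
  forall n, exists c, forall s,
    sem c s n = f (s n) /\ forall i, i < n -> sem c s i = s i.

Lemma loopable_ext f g : loopable f -> f =1 g -> loopable g.
Proof.
by move=> hf fg n; have [c hc] := hf n; exists c => s; rewrite -fg; exact: hc.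
Qed.

Lemma loopable_id : loopable id.
Proof.
move=> n; exists (Seq (Inc n.+1) (Clear n.+1)) => s; rewrite /= /upd.
split=> [|i ni]; first by rewrite !ltn_eqF.
by rewrite !ltn_eqF // ltnS ltnW.
Qed.

Lemma loopable_comp f g : loopable f -> loopable g ->
    loopable (fun x => g (f x)).
Proof.
move=> hf hg n; have [c hc] := hf n; have [d hd] := hg n.
exists (Seq c d) => s /=; have [h1 h2] := hc s; have [h3 h4] := hd (sem c s).
by rewrite h3 h1; split=> // i ni; rewrite h4 // h2.
Qed.

Lemma loopable0 : loopable (fun=> 0).
Proof.
move=> n; exists (Clear n) => s; rewrite /= updE; split=> // i ni.
by rewrite /upd ltn_eqF.
Qed.

Lemma loopableS : loopable S.
Proof.
move=> n; exists (Inc n) => s; rewrite /= updE; split=> // i ni.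
by rewrite /upd ltn_eqF.
Qed.

Lemma semSeq c d s : sem (Seq c d) s = sem d (sem c s).
Proof. by []. Qed.

Lemma semLoop r c s : sem (Loop r c) s = iter (s r) (sem c) s.
Proof. by []. Qed.

Lemma iter_inc k b s : iter k (sem (Inc b)) s = upd s b (s b + k).
Proof.
elim: k => [|k IH]; first by rewrite addn0 upd_id.
by rewrite iterS IH /= updE upd_upd addnS.
Qed.

Definition Add (a b : nat) : loop := Loop a (Inc b).

Lemma semAdd a b s : sem (Add a b) s = upd s b (s b + s a).
Proof. exact: iter_inc. Qed.

Ltac frame := rewrite ?/upd; repeat (case: eqP => ?; try lia).

Definition Copy (a b : nat) : loop := Seq (Clear b) (Add a b).

Lemma semCopy a b s : a != b -> sem (Copy a b) s = upd s b (s a).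
Proof.
by move=> ab; rewrite semSeq semAdd [sem (Clear b) s]/=
  updE upd_upd /upd (negbTE ab).
Qed.

Arguments sem : simpl never.

Lemma semSeqCopy a b c s : a != b ->
  sem (Seq (Copy a b) c) s = sem c (upd s b (s a)).
Proof. by move=> ab; rewrite semSeq semCopy. Qed.

(** The number of rounds is computed in register [n+1], which [g] is free to
overwrite: a loop reads its bound only once, at the start. *)
Lemma loopable_iter f g h : loopable f -> loopable g -> loopable h ->
  loopable (fun x => iter (f x) g (h x)).
Proof.
move=> hf hg hh n; have [cf hcf] := hf n.+1; have [cg hcg] := hg n.
have [ch hch] := hh n.+2.
exists (Seq (Copy n n.+1) (Seq cf (Seq (Copy n n.+2) (Seq ch
  (Seq (Copy n.+2 n) (Loop n.+1 cg)))))) => s.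
rewrite semSeqCopy; last lia.
rewrite semSeq semSeqCopy; last lia.
rewrite semSeq semSeqCopy; last lia.
rewrite semLoop.
set s1 := upd s _ _; have [f1 f2] := hcf s1; set s2 := sem cf s1 in f1 f2 *.
set s3 := upd s2 _ _; have [h1 h2] := hch s3; set s4 := sem ch s3 in h1 h2 *.
set s5 := upd s4 _ _.
have s1n : s1 n = s n by rewrite /s1 /upd ltn_eqF.
have s2n : s2 n = s n by rewrite f2.
have e1 : s5 n.+1 = f (s n).
  rewrite /s5 /upd gtn_eqF // h2 // /s3 /upd ltn_eqF // f1.
  by rewrite /s1 updE.
have e0 : s5 n = h (s n) by rewrite /s5 updE h1 /s3 updE s2n.
rewrite e1; elim: (f (s n)) => [|k [IH1 IH2]] /=; last first.
  have [g1 g2] := hcg (iter k (sem cg) s5); rewrite g1 IH1; split=> // i ni.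
  by rewrite g2 // IH2.
split=> // i ni; rewrite /s5; frame; rewrite h2 /s3; last lia.
by frame; rewrite f2 /s1; [frame|lia].
Qed.

(** Cantor pairing: the pairs are enumerated along the antidiagonals. *)
Fixpoint tri (n : nat) : nat := if n is m.+1 then tri m + n else 0.

Definition cpair (a b : nat) : nat := tri (a + b) + b.

Definition cnext (p : nat * nat) : nat * nat :=
  if p.1 is a.+1 then (a, p.2.+1) else (p.2.+1, 0).

Definition cunpair (n : nat) : nat * nat := iter n cnext (0, 0).

Lemma cunpairS n : cunpair n.+1 = cnext (cunpair n).
Proof. by []. Qed.

Lemma cpairK a b : cunpair (cpair a b) = (a, b).
Proof.
move: {2}(a + b) (erefl (a + b)) => k; elim: k a b => [|k IHk] a b.
  by move/eqP; rewrite addn_eq0 => /andP[/eqP-> /eqP->].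
elim: b a => [|b IHb] a e.
  have -> : cpair a 0 = (cpair 0 k).+1.
    by rewrite addn0 in e; rewrite /cpair !addn0 e /= addnS.
  by rewrite cunpairS IHk // -[a]addn0 e.
have -> : cpair a b.+1 = (cpair a.+1 b).+1 by rewrite /cpair addSnnS addnS.
by rewrite cunpairS IHb // addSnnS.
Qed.

Lemma loopable_pair f g : loopable f -> loopable g ->
  loopable (fun x => cpair (f x) (g x)).
Proof.
move=> hf hg n; have [cf hcf] := hf n.+1; have [cg hcg] := hg n.+2.
pose row := Seq (Inc n.+3) (Add n.+3 n).
exists (Seq (Copy n n.+1) (Seq cf (Seq (Copy n n.+2) (Seq cg
  (Seq (Clear n.+3) (Seq (Clear n)
    (Seq (Loop n.+1 row) (Seq (Loop n.+2 row) (Add n.+2 n))))))))) => s.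
rewrite semSeqCopy; last lia.
rewrite semSeq semSeqCopy; last lia.
rewrite 5!semSeq semAdd 2!semLoop.
set s1 := upd s _ _; have [f1 f2] := hcf s1; set s2 := sem cf s1 in f1 f2 *.
set s3 := upd s2 _ _; have [g1 g2] := hcg s3; set s4 := sem cg s3 in g1 g2 *.
set s5 := sem (Clear n) _.
have e1 : s5 n.+1 = f (s n).
  by rewrite /s5 /sem; frame; rewrite g2 // /s3; frame; rewrite f1 /s1 updE.
have e2 : s5 n.+2 = g (s n).
  by rewrite /s5 /sem; frame; rewrite g1 // /s3 updE f2 // /s1; frame.
have e0 i : i < n -> s5 i = s i.
  move=> ni; rewrite /s5 /sem; frame; rewrite g2 /s3; last lia.
  by frame; rewrite f2 /s1; [frame|lia].
have semrow t : sem row t = upd (upd t n.+3 (t n.+3).+1) n (t n + (t n.+3).+1).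
  by rewrite semSeq semAdd; apply/funext => i; rewrite /sem; frame.
(* After [t] rounds in total, register [n+3] holds [t] and [n] holds [tri t]. *)
have iter_row k t : iter k (sem row) (upd (upd s5 n.+3 t) n (tri t)) =
    upd (upd s5 n.+3 (t + k)) n (tri (t + k)).
  elim: k => [|k IH];
    rewrite ?addn0 // iterS IH semrow (addnS t k) [tri _.+1]/=.
  by apply/funext => i; frame.
have -> : s5 = upd (upd s5 n.+3 0) n (tri 0).
  by apply/funext => i; rewrite /s5 /sem; frame.
have a1 v w : upd (upd s5 n.+3 v) n w n.+1 = f (s n) by frame.
have a2 v w : upd (upd s5 n.+3 v) n w n.+2 = g (s n) by frame.
rewrite a1 iter_row a2 iter_row !updE a2 add0n; split=> // i ni.
by frame; exact: e0.
Qed.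

(** With the pair in registers [n+1] and [n+2], the inner loop makes [n+3] the
truth value of the first component being 0 and [n+4] its predecessor ([n+5] lags
one round behind). A conditional is a loop with 0 or 1 rounds. *)
Definition cnext_loop (n : nat) : loop :=
  Seq (Clear n.+3) (Seq (Inc n.+3) (Seq (Clear n.+4) (Seq (Clear n.+4.+1)
  (Seq (Loop n.+1 (Seq (Clear n.+3) (Seq (Copy n.+4.+1 n.+4) (Inc n.+4.+1))))
  (Seq (Inc n.+2) (Seq (Copy n.+4 n.+1)
  (Loop n.+3 (Seq (Copy n.+2 n.+1) (Clear n.+2))))))))).

Lemma sem_cnext_loop n s : let s' := sem (cnext_loop n) s in
  (s' n.+1, s' n.+2) = cnext (s n.+1, s n.+2) /\ forall i, i <= n -> s' i = s i.
Proof.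
rewrite /cnext_loop 4!semSeq.
set s1 := sem (Clear n.+4.+1) _; have e1 i : s1 i = if i == n.+3 then 1 else
    if i == n.+4 then 0 else if i == n.+4.+1 then 0 else s i.
  by rewrite /s1 /sem; frame.
rewrite semSeq semLoop; set s2 := iter _ _ _.
have e2 i : s2 i = if i == n.+3 then (s n.+1 == 0) : nat else
    if i == n.+4 then (s n.+1).-1 else if i == n.+4.+1 then s n.+1 else s i.
  have a1 : s1 n.+1 = s n.+1 by rewrite e1; frame.
  rewrite /s2 {}a1; elim: (s n.+1) i => [|k IH] i.
    by rewrite /= e1; frame.
  rewrite iterS; set t := iter k _ _ in IH *.
  rewrite semSeq semSeqCopy; last lia.
  rewrite /sem /upd.
  by move: (IH i) (IH n.+4.+1); frame.
rewrite semSeq semSeqCopy; last lia.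
rewrite semLoop.
set s3 := upd _ _ _.
have e3 i : s3 i = if i == n.+1 then (s n.+1).-1 else
    if i == n.+2 then (s n.+2).+1 else s2 i.
  by move: (e2 i) (e2 n.+2) (e2 n.+4); rewrite /s3 /sem; frame.
have -> : s3 n.+3 = (s n.+1 == 0) by rewrite e3 e2; frame.
have b1 : s3 n.+1 = (s n.+1).-1 by rewrite e3; frame.
have b2 : s3 n.+2 = (s n.+2).+1 by rewrite e3; frame.
have b0 i : i <= n -> s3 i = s i by move=> ni; rewrite e3 e2; frame.
rewrite /cnext /=; case: (s n.+1) b1 => [|a] /= b1; last first.
  by rewrite b1 b2; split.
rewrite semSeqCopy; last lia.
rewrite /sem b2; split=> [|i ni]; last by frame; exact: b0.
by congr pair; frame.
Qed.

Lemma loopable_unpair f : loopable f ->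
  loopable (fun x => (cunpair (f x)).1) /\
    loopable (fun x => (cunpair (f x)).2).
Proof.
move=> hf; suff [h1 h2] : loopable (fun x => (cunpair x).1) /\
    loopable (fun x => (cunpair x).2).
  split; first exact: loopable_comp hf h1.
  exact: loopable_comp hf h2.
suff key n s : let s' := iter (s n) (sem (cnext_loop n))
      (sem (Clear n.+2) (sem (Clear n.+1) s)) in
    (s' n.+1, s' n.+2) = cunpair (s n) /\ forall i, i <= n -> s' i = s i.
  split=> n.
    exists (Seq (Clear n.+1) (Seq (Clear n.+2) (Seq (Loop n (cnext_loop n))
      (Copy n.+1 n)))) => s; have [e1 e2] := key n s.
    rewrite 3!semSeq semLoop semCopy; last lia.
    have -> : sem (Clear n.+2) (sem (Clear n.+1) s) n = s n.
  by rewrite /sem; frame.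
    split=> [|i ni]; first by rewrite updE -e1.
    by frame; rewrite e2 // ltnW.
  exists (Seq (Clear n.+1) (Seq (Clear n.+2) (Seq (Loop n (cnext_loop n))
    (Copy n.+2 n)))) => s; have [e1 e2] := key n s.
  rewrite 3!semSeq semLoop semCopy; last lia.
  have -> : sem (Clear n.+2) (sem (Clear n.+1) s) n = s n.
  by rewrite /sem; frame.
  split=> [|i ni]; first by rewrite updE -e1.
  by frame; rewrite e2 // ltnW.
elim: (s n) => [|k [IH1 IH2]] /=.
  by split=> [|i ni]; rewrite /sem; [congr pair|]; frame.
set s' := iter k _ _ in IH1 IH2 *; have [h1 h2] := sem_cnext_loop n s'.
rewrite h1 IH1; split=> // i ni.
by rewrite h2 // IH2.
Qed.

(** Both branches are computed, which does no harm since they terminate.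
Stepping from [(a, b)] to [(b, b)] then selects between them. *)
Lemma loopable_if f g h : loopable f -> loopable g -> loopable h ->
  loopable (fun x => if f x == 0 then g x else h x).
Proof.
move=> hf hg hh.
pose sw y := cpair (cunpair y).2 (cunpair y).2.
have hsw : loopable sw.
  by apply: loopable_pair; exact: (loopable_unpair loopable_id).2.
apply: loopable_ext
  (loopable_unpair (loopable_iter hf hsw (loopable_pair hg hh))).1 _ => x /=.
case: (f x) => [|k]; first by rewrite /= cpairK.
suff -> : iter k.+1 sw (cpair (g x) (h x)) = cpair (h x) (h x) by
  rewrite cpairK.
by elim: k => [|k IH]; rewrite iterS ?IH /sw cpairK.
Qed.

Lemma loopable_pred f : loopable f -> loopable (fun x => (f x).-1).
Proof.
move=> hf; suff h : loopable predn by exact: loopable_comp hf h.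
pose nx y := cpair (cunpair y).2 (cunpair y).2.+1.
have [_ h2] := loopable_unpair loopable_id.
have hn : loopable nx.
  by apply: loopable_pair => //; exact: loopable_comp h2 loopableS.
apply: loopable_ext
  (loopable_unpair (loopable_iter loopable_id hn loopable0)).1 _ => n.
suff -> : iter n nx 0 = cpair n.-1 n by rewrite cpairK.
elim: n => // n IH; rewrite iterS IH /nx cpairK //.
Qed.

(** * Effective functions between coded types *)

(** Programs are specified by what they do on codes of data, so that an
arbitrary function may serve as the encoding. *)
Class coded (T : Type) := encode : T -> nat.

Instance coded_nat : coded nat := id.
Instance coded_bool : coded bool := nat_of_bool.
Instance coded_pair S T {cS : coded S} {cT : coded T} : coded (S * T) :=
  fun p => cpair (encode p.1) (encode p.2).
Instance coded_seq T {cT : coded T} : coded (seq T) :=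
  foldr (fun a m => (cpair (encode a) m).+1) 0.
Instance coded_instr : coded instr := fun i => encode (encode_instr i).
Instance coded_config : coded config :=
  fun c => encode (state c, (inpos c, (work c, out c))).

Definition effective S T {cS : coded S} {cT : coded T} (f : S -> T) : Prop :=
  exists2 g, loopable g & forall x, g (encode x) = encode (f x).

Section Closure.
Context {S : Type} {cS : coded S}.

Lemma eff_id : effective (fun x : S => x).
Proof. by exists id => //; exact: loopable_id. Qed.

Lemma eff_comp T U {cT : coded T} {cU : coded U} (f : S -> T) (g : T -> U) :
  effective g -> effective f -> effective (fun x => g (f x)).
Proof.
move=> [gg hg eg] [ff hf ef]; exists (fun n => gg (ff n)).
  exact: loopable_comp.
by move=> x; rewrite ef eg.
Qed.

Lemma loopable_const k : loopable (fun=> k).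
Proof.
elim: k => [|k IH]; first exact: loopable0.
exact: loopable_comp IH loopableS.
Qed.

Lemma eff_const T {cT : coded T} (a : T) : effective (fun _ : S => a).
Proof. by exists (fun=> encode a) => //; exact: loopable_const. Qed.

Lemma eff_recode T U {cT : coded T} {cU : coded U} (f : S -> T) (g : S -> U) :
  (forall x, encode (g x) = encode (f x)) -> effective f -> effective g.
Proof. by move=> e [ff hf ef]; exists ff => // x; rewrite e. Qed.

Lemma eff_pair T U {cT : coded T} {cU : coded U} (f : S -> T) (g : S -> U) :
  effective f -> effective g -> effective (fun x => (f x, g x)).
Proof.
move=> [ff hf ef] [gg hg eg]; exists (fun n => cpair (ff n) (gg n)).
  exact: loopable_pair.
by move=> x; rewrite ef eg.
Qed.

Lemma eff_fst T U {cT : coded T} {cU : coded U} (f : S -> T * U) :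
  effective f -> effective (fun x => (f x).1).
Proof.
move=> [ff hf ef]; exists (fun n => (cunpair (ff n)).1).
  exact: (loopable_unpair hf).1.
by move=> x; rewrite ef cpairK.
Qed.

Lemma eff_snd T U {cT : coded T} {cU : coded U} (f : S -> T * U) :
  effective f -> effective (fun x => (f x).2).
Proof.
move=> [ff hf ef]; exists (fun n => (cunpair (ff n)).2).
  exact: (loopable_unpair hf).2.
by move=> x; rewrite ef cpairK.
Qed.

Lemma eff_if T {cT : coded T} (b : S -> bool) (f g : S -> T) :
  effective b -> effective f -> effective g ->
  effective (fun x => if b x then f x else g x).
Proof.
move=> [bb hb eb] [ff hf ef] [gg hg eg].
exists (fun n => if bb n == 0 then gg n else ff n); first exact: loopable_if.
by move=> x; rewrite eb ef eg; case: (b x).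
Qed.

(** A nonempty list is coded by the successor of a pair, so that the predecessor
of its code, paired with the code of [x], is an argument for [g]. *)
Lemma eff_case T U {cT : coded T} {cU : coded U} (l : S -> seq T) (f : S -> U)
    (g : S -> T -> seq T -> U) :
  effective l -> effective f ->
  effective (fun y : S * (T * seq T) => g y.1 y.2.1 y.2.2) ->
  effective (fun x => if l x is a :: s then g x a s else f x).
Proof.
move=> [ll hl el] [ff hf ef] [gg hg eg].
exists (fun n => if ll n == 0 then ff n else gg (cpair n (ll n).-1)).
  apply: loopable_if => //; apply: loopable_comp hg.
  by apply: loopable_pair; [exact: loopable_id|exact: loopable_pred].
move=> x; rewrite el ef; case: (l x) => [//|a s] /=.
exact: (eg (x, (a, s))).
Qed.

Lemma eff_S (f : S -> nat) : effective f -> effective (fun x => (f x).+1).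
Proof.
move=> [ff hf ef]; exists (fun n => (ff n).+1); first
  exact: loopable_comp hf loopableS.
by move=> x; rewrite ef.
Qed.

Lemma eff_pred (f : S -> nat) : effective f -> effective (fun x => (f x).-1).
Proof.
move=> [ff hf ef]; exists (fun n => (ff n).-1); first exact: loopable_pred.
by move=> x; rewrite ef.
Qed.

Lemma eff_is0 (f : S -> nat) : effective f -> effective (fun x => f x == 0).
Proof.
move=> [ff hf ef]; exists (fun n => if ff n == 0 then 1 else 0).
  by apply: loopable_if => //; exact: loopable_const.
by move=> x; rewrite ef; case: (f x).
Qed.

Lemma eff_iter T {cT : coded T} (n : S -> nat) (g : S -> T -> T) (h : S -> T) :
  effective n -> effective (fun y : S * T => g y.1 y.2) -> effective h ->
  effective (fun x => iter (n x) (g x) (h x)).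
Proof.
move=> [nn hn en] [gg hg eg] [hh hhh eh].
exists (fun m => (cunpair (iter (nn m)
  (fun p => cpair (cunpair p).1 (gg p)) (cpair m (hh m)))).2).
  apply: (loopable_unpair _).2; apply: loopable_iter => //; last first.
    by apply: loopable_pair => //; exact: loopable_id.
  by apply: loopable_pair => //; exact: (loopable_unpair loopable_id).1.
move=> x; rewrite en eh.
have it k : iter k (fun p => cpair (cunpair p).1 (gg p))
    (cpair (encode x) (encode (h x))) = encode (x, iter k (g x) (h x)).
  by elim: k => [//|k IH]; rewrite !iterS IH eg {1}/encode /= cpairK.
by rewrite it cpairK.
Qed.

Lemma eff_cons T {cT : coded T} (f : S -> T) (g : S -> seq T) :
  effective f -> effective g -> effective (fun x => f x :: g x).
Proof.
move=> [ff hf ef] [gg hg eg]; exists (fun n => (cpair (ff n) (gg n)).+1).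
  exact: loopable_comp (loopable_pair hf hg) loopableS.
by move=> x; rewrite ef eg.
Qed.

End Closure.

(** The closure lemmas are selected by the syntax of the goal: unification alone
would look for them behind the definitions of the functions at hand. *)
Ltac effs := cbv beta; try assumption; lazymatch goal with
  | |- effective (fun x => x) => exact: eff_id
  | |- effective (fun _ => ?c) => exact: eff_const
  | |- effective (fun x => (@?f x, @?g x)) =>
      apply: (eff_pair (f := f) (g := g)); effs
  | |- effective predn => exact: (eff_pred (f := id) eff_id)
  | |- effective fst => exact: (eff_fst (f := id) eff_id)
  | |- effective snd => exact: (eff_snd (f := id) eff_id)
  | |- effective (fun x => fst (@?f x)) => apply: (eff_fst (f := f)); effs
  | |- effective (fun x => snd (@?f x)) => apply: (eff_snd (f := f)); effs
  | |- effective (fun x => (@?f x).+1) => apply: (eff_S (f := f)); effs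
  | |- effective (fun x => (@?f x).-1) => apply: (eff_pred (f := f)); effs
  | |- effective (fun x => @?f x == 0) => apply: (eff_is0 (f := f)); effs
  | |- effective (fun x => @?f x :: @?g x) =>
      apply: (eff_cons (f := f) (g := g)); effs
  | _ => idtac
  end.

Lemma eff_neg S {cS : coded S} (b : S -> bool) : effective b ->
    effective (fun x => ~~ b x).
Proof. by move=> h; apply: eff_if => //; exact: eff_const. Qed.

Lemma eff_and S {cS : coded S} (b : S -> bool) (c : S -> bool) : effective b ->
    effective c -> effective (fun x => b x && c x).
Proof. by move=> hb hc; apply: eff_if => //; exact: eff_const. Qed.

Lemma eff_or S {cS : coded S} (b : S -> bool) (c : S -> bool) : effective b ->
    effective c -> effective (fun x => b x || c x).
Proof. by move=> hb hc; apply: eff_if => //; exact: eff_const. Qed.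

Lemma eff_sub S {cS : coded S} (m : S -> nat) (n : S -> nat) : effective m ->
    effective n -> effective (fun x => m x - n x).
Proof.
move=> hm hn.
have -> : (fun x => m x - n x) = fun x => iter (n x) predn (m x).
  by apply/funext => x; elim: (n x) => [|k IH];
    rewrite ?subn0 // iterS -IH subnS.
by apply: eff_iter => //; effs.
Qed.

Lemma eff_add S {cS : coded S} (m : S -> nat) (n : S -> nat) : effective m ->
    effective n -> effective (fun x => m x + n x).
Proof.
move=> hm hn.
have -> : (fun x => m x + n x) = fun x => iter (n x) Datatypes.S (m x).
  by apply/funext => x; elim: (n x) => [|k IH];
    rewrite ?addn0 // iterS -IH addnS.
by apply: eff_iter => //; effs.
Qed.

Lemma eff_leq S {cS : coded S} (m : S -> nat) (n : S -> nat) : effective m ->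
    effective n -> effective (fun x => m x <= n x).
Proof. by move=> hm hn; apply: eff_is0; exact: eff_sub. Qed.

Lemma eff_eqn S {cS : coded S} (m : S -> nat) (n : S -> nat) : effective m ->
    effective n -> effective (fun x => m x == n x).
Proof.
move=> hm hn.
have -> : (fun x => m x == n x) = fun x => (m x <= n x) && (n x <= m x).
  by apply/funext => x; rewrite eqn_leq.
by apply: eff_and; exact: eff_leq.
Qed.

Lemma eff_odd S {cS : coded S} (n : S -> nat) : effective n ->
    effective (fun x => odd (n x)).
Proof.
move=> hn; have -> : (fun x => odd (n x)) = fun x => iter (n x) negb false.
  by apply/funext => x; elim: (n x) => //= k ->.
by apply: eff_iter; effs; apply: eff_neg; effs.
Qed.

Lemma eff_half S {cS : coded S} (n : S -> nat) : effective n ->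
    effective (fun x => (n x)./2).
Proof.
move=> hn.
have -> : (fun x => (n x)./2) =
    fun x => (iter (n x) (fun p => (p.2, p.1.+1)) (0, 0)).1.
  apply/funext => x.
  suff -> : iter (n x) (fun p => (p.2, p.1.+1)) (0, 0) =
      ((n x)./2, uphalf (n x)).
    by [].
  by elim: (n x) => // k IH; rewrite iterS IH.
by apply: eff_fst; apply: eff_iter => //; effs.
Qed.

Lemma eff_double S {cS : coded S} (n : S -> nat) : effective n ->
    effective (fun x => (n x).*2).
Proof.
move=> hn; have -> : (fun x => (n x).*2) = fun x => n x + n x.
  by apply/funext => x; rewrite addnn.
exact: eff_add.
Qed.

Lemma eff_behead S {cS : coded S} T {cT : coded T} (l : S -> seq T) :
    effective l -> effective (fun x => behead (l x)).
Proof.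
move=> hl; have -> : (fun x => behead (l x)) =
    fun x => if l x is _ :: s then s else [::].
  by apply/funext => x; case: (l x).
by apply: eff_case; effs.
Qed.

Lemma eff_head S {cS : coded S} T {cT : coded T} {t : T} (l : S -> seq T) :
    effective l -> effective (fun x => head t (l x)).
Proof.
move=> hl; have -> : (fun x => head t (l x)) =
    fun x => if l x is a :: s then a else t by apply/funext => x; case: (l x).
by apply: eff_case; effs.
Qed.

(** The code of a list is available as a number and bounds the length, which
gives a number of rounds sufficient for traversing the list. *)
Lemma size_encode T {cT : coded T} (s : seq T) : size s <= encode s.
Proof.
elim: s => //= a s IH; rewrite {1}/encode /=; apply: leq_trans IH _.
by rewrite /cpair; exact: leq_addl.
Qed.

Lemma eff_foldl S {cS : coded S} T {cT : coded T} U {cU : coded U}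
    (g : S -> U -> T -> U) (h : S -> U) (l : S -> seq T) :
  effective (fun y : S * (U * T) => g y.1 y.2.1 y.2.2) -> effective h ->
  effective l -> effective (fun x => foldl (g x) (h x) (l x)).
Proof.
move=> hg hh hl.
pose next x (p : U * seq T) :=
  if p.2 is t :: s then (g x p.1 t, s) else (p.1, [::]).
have next_size x k : forall p : U * seq T, size p.2 <= k ->
    (iter k (next x) p).1 = foldl (g x) p.1 p.2.
  elim: k => [|k IH] [u s]; first by case: s.
  by case: s => [|t s] le_sk; rewrite iterSr IH.
have -> : (fun x => foldl (g x) (h x) (l x)) =
    fun x => (iter (encode (l x)) (next x) (h x, l x)).1.
  by apply/funext => x; rewrite next_size //= size_encode.
apply: eff_fst; apply: eff_iter; [exact: eff_recode hl| |exact: eff_pair].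
apply: eff_case; effs.
pose r (z : S * (U * seq T) * (T * seq T)) := (z.1.1, (z.1.2.1, z.2.1)).
by apply: (eff_comp (f := r) hg); rewrite /r; effs.
Qed.

Lemma eff_rev S {cS : coded S} T {cT : coded T} (l : S -> seq T) :
    effective l -> effective (fun x => rev (l x)).
Proof.
move=> hl; have -> : (fun x => rev (l x)) =
    fun x => foldl (fun s t => t :: s) [::] (l x).
  by apply/funext => x; rewrite /rev; elim: (l x) [::] => //= t s IH s'.
by apply: eff_foldl; effs.
Qed.

Lemma eff_cat S {cS : coded S} T {cT : coded T} (l : S -> seq T)
    (l' : S -> seq T) : effective l -> effective l' ->
    effective (fun x => l x ++ l' x).
Proof.
move=> hl hl'; have -> : (fun x => l x ++ l' x) =
    fun x => foldl (fun s t => t :: s) (l' x) (rev (l x)).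
  apply/funext => x; rewrite -[in LHS](revK (l x)).
  by elim: (rev (l x)) (l' x) => //= t s IH s'; rewrite rev_cons cat_rcons IH.
by apply: eff_foldl; effs; exact: eff_rev.
Qed.

Lemma eff_rcons S {cS : coded S} T {cT : coded T} (l : S -> seq T)
    (a : S -> T) : effective l -> effective a ->
  effective (fun x => rcons (l x) (a x)).
Proof.
move=> hl ha; have -> : (fun x => rcons (l x) (a x)) = fun x => l x ++ [:: a x].
  by apply/funext => x; rewrite cats1.
by apply: eff_cat; effs.
Qed.

Lemma eff_size S {cS : coded S} T {cT : coded T} (l : S -> seq T) :
    effective l -> effective (fun x => size (l x)).
Proof.
move=> hl; have -> : (fun x => size (l x)) =
    fun x => foldl (fun m _ => m.+1) 0 (l x).
  apply/funext => x; rewrite -[LHS]addn0.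
  by elim: (l x) 0 => //= t s IH m; rewrite -IH addSnnS.
by apply: eff_foldl; effs.
Qed.

Lemma eff_drop S {cS : coded S} T {cT : coded T} (n : S -> nat)
    (l : S -> seq T) : effective n -> effective l ->
    effective (fun x => drop (n x) (l x)).
Proof.
move=> hn hl; have -> : (fun x => drop (n x) (l x)) =
    fun x => iter (n x) behead (l x) by apply/funext => x; rewrite drop_behead.
by apply: eff_iter => //; apply: eff_behead; effs.
Qed.

Lemma eff_take S {cS : coded S} T {cT : coded T} (n : S -> nat)
    (l : S -> seq T) : effective n -> effective l ->
    effective (fun x => take (n x) (l x)).
Proof.
move=> hn hl; have -> : (fun x => take (n x) (l x)) =
    fun x => rev (drop (size (l x) - n x) (rev (l x))).
  by apply/funext => x; rewrite -[in LHS](revK (l x)) take_rev size_rev.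
apply: eff_rev; apply: eff_drop; last exact: eff_rev.
by apply: eff_sub => //; exact: eff_size.
Qed.

Lemma eff_nth S {cS : coded S} T {cT : coded T} {t : T} (l : S -> seq T)
    (n : S -> nat) : effective l -> effective n ->
    effective (fun x => nth t (l x) (n x)).
Proof.
move=> hl hn; have -> : (fun x => nth t (l x) (n x)) =
    fun x => head t (drop (n x) (l x)).
  by apply/funext => x; rewrite -nth0 nth_drop addn0.
by apply: eff_head; exact: eff_drop.
Qed.

Lemma eff_nseq S {cS : coded S} T {cT : coded T} (n : S -> nat) (a : S -> T) :
    effective n -> effective a -> effective (fun x => nseq (n x) (a x)).
Proof.
move=> hn ha.
apply: (@eff_iter _ _ _ _ n (fun x => cons (a x)) (fun=> [::])) => //.
  by apply: eff_cons; [apply: (eff_comp ha)|]; effs.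
exact: eff_const.
Qed.

Lemma eff_set_nth S {cS : coded S} T {cT : coded T} {t : T} (l : S -> seq T)
    (n : S -> nat) (a : S -> T) : effective l -> effective n -> effective a ->
  effective (fun x => set_nth t (l x) (n x) (a x)).
Proof.
move=> hl hn ha; have -> : (fun x => set_nth t (l x) (n x) (a x)) =
    fun x => if n x < size (l x)
             then take (n x) (l x) ++ a x :: drop (n x).+1 (l x)
             else l x ++ (nseq (n x - size (l x)) t ++ [:: a x]).
  apply/funext => x; rewrite set_nthE; case: ifP => // _.
  by rewrite -cat_nseq.
have hs := eff_size hl; apply: eff_if.
- by apply: eff_leq => //; exact: eff_S.
- by apply: eff_cat; [exact: eff_take|effs; apply: eff_drop; effs].
- apply: eff_cat => //; apply: eff_cat; last by effs.
  by apply: eff_nseq; [exact: eff_sub|exact: eff_const].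
Qed.

Lemma eff_mkseq S {cS : coded S} T {cT : coded T} (n : S -> nat)
    (g : S -> nat -> T) : effective n ->
  effective (fun y : S * nat => g y.1 y.2) ->
  effective (fun x => mkseq (g x) (n x)).
Proof.
move=> hn hg; have -> : (fun x => mkseq (g x) (n x)) =
    fun x => rev (iter (n x) (fun s => g x (size s) :: s) [::]).
  apply/funext => x; elim: (n x) => [//|k IH].
  have e : size (iter k (fun s => g x (size s) :: s) [::]) = k.
    by elim: k {IH} => //= k ->.
  by rewrite iterS rev_cons -IH e /mkseq -addn1 iotaD map_cat cats1.
apply: eff_rev; apply: eff_iter => //; last exact: eff_const.
apply: eff_cons; last by effs.
apply: (eff_comp (f := fun y : S * seq T => (y.1, size y.2)) hg).
by effs; apply: eff_size; effs.
Qed.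

Lemma eff_map S {cS : coded S} T {cT : coded T} U {cU : coded U}
    (g : S -> T -> U) (l : S -> seq T) :
  effective (fun y : S * T => g y.1 y.2) -> effective l ->
  effective (fun x => [seq g x t | t <- l x]).
Proof.
move=> hg hl; have -> : (fun x => [seq g x t | t <- l x]) =
    fun x => rev (foldl (fun s t => g x t :: s) [::] (l x)).
  apply/funext => x; rewrite -[LHS]cat0s -[[::] in LHS]/(rev [::]).
  elim: (l x) [::] => [|t s IH] s' /=; first by rewrite cats0.
  by rewrite -IH rev_cons cat_rcons.
apply: eff_rev; apply: eff_foldl; effs.
by apply: (eff_comp (f := fun y : S * (seq U * T) => (y.1, y.2.2)) hg); effs.
Qed.

Lemma eff_flatten S {cS : coded S} T {cT : coded T} (l : S -> seq (seq T)) :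
  effective l -> effective (fun x => flatten (l x)).
Proof.
move=> hl; have -> : (fun x => flatten (l x)) = fun x => foldl cat [::] (l x).
  apply/funext => x; rewrite -[LHS]cat0s.
  by elim: (l x) [::] => [|t s IH] s' /=; rewrite ?cats0 // catA IH.
by apply: eff_foldl; effs; apply: eff_cat; effs.
Qed.

Lemma eff_mem0 S {cS : coded S} (l : S -> seq nat) :
  effective l -> effective (fun x => 0 \in l x).
Proof.
move=> hl; have -> : (fun x => 0 \in l x) =
    fun x => foldl (fun b t => b || (t == 0)) false (l x).
  apply/funext => x; rewrite -[LHS]orFb.
  elim: (l x) false => [|t s IH] b /=; first by rewrite orbF.
  by rewrite inE eq_sym orbA IH.
by apply: eff_foldl; effs; apply: eff_or; effs.
Qed.

(** * Effective simulation of machines *)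

Instance coded_program : coded program := @coded_seq instr _.
Instance coded_wtape : coded wtape := @coded_pair (seq nat) (seq nat) _ _.

Ltac effl := effs; try assumption; lazymatch goal with
  | |- effective (fun x => ~~ @?f x) => apply: (eff_neg (b := f)); effl
  | |- effective (fun x => @?f x && @?g x) =>
      apply: (eff_and (b := f) (c := g)); effl
  | |- effective (fun x => @?f x || @?g x) =>
      apply: (eff_or (b := f) (c := g)); effl
  | |- effective (fun x => @?f x == @?g x) =>
      apply: (eff_eqn (m := f) (n := g)); effl
  | |- effective (fun x => head _ (@?f x)) => apply: (eff_head (l := f)); effl
  | |- effective (fun x => behead (@?f x)) => apply: (eff_behead (l := f)); effl
  | |- effective (fun x => size (@?f x)) => apply: (eff_size (l := f)); effl
  | |- effective (fun x => rev (@?f x)) => apply: (eff_rev (l := f)); effl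
  | |- effective (fun x => nth _ (@?f x) (@?g x)) =>
      apply: (eff_nth (l := f) (n := g)); effl
  | |- effective (fun x => set_nth _ (@?f x) (@?g x) (@?h x)) =>
      apply: (eff_set_nth (l := f) (n := g) (a := h)); effl
  | |- effective (fun x => rcons (@?f x) (@?g x)) =>
      apply: (eff_rcons (l := f) (a := g)); effl
  | |- effective (fun x => (@?f x)./2) => apply: (eff_half (n := f)); effl
  | |- effective (fun x => (@?f x).*2) => apply: (eff_double (n := f)); effl
  | |- effective (fun x => odd (@?f x)) => apply: (eff_odd (n := f)); effl
  | _ => idtac
  end.

Section Configurations.
Context {S : Type} {cS : coded S}.

Lemma eff_config_tuple (c : S -> config) : effective c ->
  effective (fun x => (state (c x), (inpos (c x), (work (c x), out (c x))))).
Proof. exact: eff_recode. Qed.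

Lemma eff_state (c : S -> config) : effective c ->
    effective (fun x => state (c x)).
Proof. by move/eff_config_tuple/eff_fst. Qed.

Lemma eff_inpos (c : S -> config) : effective c ->
    effective (fun x => inpos (c x)).
Proof. by move/eff_config_tuple/eff_snd/eff_fst. Qed.

Lemma eff_work (c : S -> config) : effective c ->
    effective (fun x => work (c x)).
Proof. by move/eff_config_tuple/eff_snd/eff_snd/eff_fst. Qed.

Lemma eff_out (c : S -> config) : effective c -> effective (fun x => out (c x)).
Proof. by move/eff_config_tuple/eff_snd/eff_snd/eff_snd. Qed.

Lemma eff_Config s i w o : effective s -> effective i -> effective w ->
  effective o -> effective (fun x : S => Config (s x) (i x) (w x) (o x)).
Proof.
move=> hs hi hw ho; apply: (@eff_recode _ _ _ _ _ _
  (fun x => (s x, (i x, (w x, o x))))) => //.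
by effs.
Qed.

End Configurations.

Lemma eff_move_left : effective move_left.
Proof.
by apply: (eff_pair (f := fun w : wtape => behead w.1)
  (g := fun w : wtape => head 0 w.1 :: w.2)); effl.
Qed.

Lemma eff_move_right : effective move_right.
Proof.
by apply: (eff_pair (f := fun w : wtape => head 0 w.2 :: w.1)
  (g := fun w : wtape => behead w.2)); effl.
Qed.

(** The program is an argument of the step function, which is the core of the
universal machine. *)
Lemma eff_step S {cS : coded S} (M : S -> program) (b : S -> seq bool)
    (c : S -> config) : effective M -> effective b -> effective c ->
  effective (fun x => step (M x) (nth false (b x)) (c x)).
Proof.
move=> hM hb hc.
have hs := eff_state hc; have hi := eff_inpos hc; have hw := eff_work hc.
have ho := eff_out hc.
pose e x := encode_instr (nth Halt (M x) (state (c x))).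
have he : effective e.
  by apply: (@eff_recode _ _ _ _ _ _ (fun x => nth Halt (M x) (state (c x)))) =>
    //; effl.
pose arg k x := nth 0 (e x) k.
have ha k : effective (arg k) by rewrite /arg; effl.
(* [Halt] is coded by the empty list; the default 9 is not an opcode. *)
pose op x := nth 9 (e x) 0.
have hop : effective op by rewrite /op; effl.
pose tape x := nth blank (work (c x)) (arg 1 x).
have ht : effective tape by rewrite /tape; effl.
pose put (x : S) w := set_nth blank (work (c x)) (arg 1 x) w.
pose stepf x :=
  if op x == 0 then Config (state (c x)).+1 (inpos (c x))
    (put x (move_left (tape x))) (out (c x)) else
  if op x == 1 then Config (state (c x)).+1 (inpos (c x))
    (put x (move_right (tape x))) (out (c x)) else
  if op x == 2 then Config (state (c x)).+1 (inpos (c x))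
    (put x ((tape x).1, arg 2 x :: behead (tape x).2)) (out (c x)) else
  if op x == 3 then Config
    (if head 0 (tape x).2 == arg 2 x then arg 3 x else (state (c x)).+1)
    (inpos (c x)) (work (c x)) (out (c x)) else
  if op x == 4 then
    Config (state (c x)).+1 (inpos (c x)).+1 (work (c x)) (out (c x)) else
  if op x == 5 then Config
    (if nth false (b x) (inpos (c x)) then arg 1 x else (state (c x)).+1)
    (inpos (c x)) (work (c x)) (out (c x)) else
  if op x == 6 then Config (state (c x)).+1 (inpos (c x)) (work (c x))
    (rcons (out (c x)) (arg 1 x != 0)) else c x.
have -> : (fun x => step (M x) (nth false (b x)) (c x)) = stepf.
  apply/funext => x; rewrite /stepf /put /tape /op /arg /e /step /update.
  case: (c x) => s i ws o /=.
  by case: (nth Halt (M x) s) => //= -[].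
have hput w : effective w -> effective (fun x => put x (w x)).
  by move=> ?; rewrite /put; effl.
have hml : effective (fun x => put x (move_left (tape x))).
  by apply: hput; apply: (eff_comp eff_move_left).
have hmr : effective (fun x => put x (move_right (tape x))).
  by apply: hput; apply: (eff_comp eff_move_right).
have hwr : effective (fun x => put x ((tape x).1,
  arg 2 x :: behead (tape x).2)).
  by apply: hput; effl; apply: ha.
have hop_eq k : effective (fun x => op x == k) by effl.
have hj : effective (fun x => if head 0 (tape x).2 == arg 2 x then arg 3 x
    else (state (c x)).+1).
  by apply: eff_if; effl; apply: ha.
have hji : effective (fun x => if nth false (b x) (inpos (c x)) then arg 1 x
    else (state (c x)).+1).
  by apply: eff_if; effl; apply: ha.
have hout : effective (fun x => rcons (out (c x)) (arg 1 x != 0)).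
  by effl; apply: ha.
by rewrite /stepf; do 7 (apply: eff_if => //; first by apply: eff_Config; effl).
Qed.

(** The output that can be predicted from a finite prefix [b] of the input. A
step advances the input head by at most one position, so within [size b] steps
the machine never looks beyond [b]. *)
Definition sim (M : program) (b : seq bool) : seq bool :=
  out (run M (nth false b) (size b)).

Lemma eff_sim S {cS : coded S} (M : S -> program) (b : S -> seq bool) :
  effective M -> effective b -> effective (fun x => sim (M x) (b x)).
Proof.
move=> hM hb; apply: eff_out; apply: eff_iter; effl.
apply: eff_step; effs.
  by apply: (eff_comp (f := fst) hM); effs.
by apply: (eff_comp (f := fst) hb); effs.
Qed.

(** One unfolding of [CodeSeq.decode_rec v q r], with the entries already
produced collected in reverse order. *)
Definition decode_step (z : seq nat * (nat * (nat * nat))) :=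
  let: (acc, (v, (q, r))) := z in
  if r == 0 then (v :: acc, (0, (q.-1, q.-1)))
  else if r == 1 then (acc, (v.+1, (q.-1, q.-1)))
  else (acc, (v, (q.-1, r.-1.-1))).

Lemma decode_stepE q : forall acc v r,
  let z := iter q decode_step (acc, (v, (q, r))) in
  rev (z.2.1 :: z.1) = rev acc ++ CodeSeq.decode_rec v q r.
Proof.
elim: q => [|q IH] acc v r; first by rewrite /= rev_cons cats1.
rewrite iterSr; case: r => [|[|r]] /=; rewrite IH //.
by rewrite rev_cons cat_rcons.
Qed.

Lemma eff_decode : effective CodeSeq.decode.
Proof.
pose start (n : nat) : seq nat * (nat * (nat * nat)) :=
  ([::], (0, (n.-1, n.-1))).
pose last n := iter n.-1 decode_step (start n).
have -> : CodeSeq.decode =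
    fun n => if n == 0 then [::] else rev ((last n).2.1 :: (last n).1).
  by apply/funext => -[|n] //=; rewrite /last decode_stepE.
have hlast : effective last.
  apply: eff_iter; rewrite /start; effs.
  pose d (z : nat * (seq nat * (nat * (nat * nat)))) :=
    if z.2.2.2.2 == 0 then (z.2.2.1 :: z.2.1, (0, (z.2.2.2.1.-1, z.2.2.2.1.-1)))
    else if z.2.2.2.2 == 1
    then (z.2.1, (z.2.2.1.+1, (z.2.2.2.1.-1, z.2.2.2.1.-1)))
    else (z.2.1, (z.2.2.1, (z.2.2.2.1.-1, z.2.2.2.2.-1.-1))).
  apply: (@eff_recode _ _ _ _ _ _ d) => [[n [acc [v [q r]]]] //|].
  by rewrite /d; do 2 (apply: eff_if; effl).
by apply: eff_if; effl.
Qed.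

(** Decoding an instruction sends ill-formed lists to [Halt] and normalizes the
bit of an [Output]; this is the resulting function on the codes themselves. *)
Definition normal_instr (c : seq nat) : seq nat :=
  let k := nth 0 c 0 in let n := size c in
  if n == 1 then if k == 4 then c else [::]
  else if n == 2 then
    if (k == 0) || (k == 1) || (k == 5) then c
    else if k == 6 then [:: 6; nat_of_bool (nth 0 c 1 != 0)] else [::]
  else if n == 3 then if k == 2 then c else [::]
  else if n == 4 then if k == 3 then c else [::]
  else [::].

Lemma encode_decode_instr c : encode_instr (decode_instr c) = normal_instr c.
Proof.
by case: c => [|k [|a [|b [|j [|? ?]]]]] //; case: k => [|[|[|[|[|[|[|?]]]]]]].
Qed.

Lemma eff_program_of : effective program_of.
Proof.
rewrite /program_of; apply: eff_map; last exact: eff_decode.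
apply: (@eff_recode _ _ _ _ _ _ (fun y : nat * nat =>
  normal_instr (CodeSeq.decode y.2))).
  by move=> y; rewrite -encode_decode_instr.
apply: (eff_comp (f := fun y => CodeSeq.decode y.2) (g := normal_instr));
  last first.
  by apply: (eff_comp eff_decode); effs.
rewrite /normal_instr; do ! (apply: eff_if; effl).
Qed.

(** * Streams approximated by finite prefixes *)

Section Approximation.
Variables T U : Type.
Implicit Types (x : nat -> T) (y : nat -> U).

Definition approx R (s : seq R) (x : nat -> R) : Prop := s = mkseq x (size s).

(** [F] is a finitary approximation of a function that maps [x] to [y]: on
prefixes of [x] its values are prefixes of [y], and they become arbitrarily
long. Unlike monotonicity, this makes no claim about [F] elsewhere and is
preserved by composition without side conditions. *)
Definition tends (F : seq T -> seq U) x y : Prop :=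
  (forall s, approx s x -> approx (F s) y) /\
  forall n, exists m, forall s, approx s x -> m <= size s -> n <= size (F s).

End Approximation.

Lemma approx_mkseq T (x : nat -> T) n : approx (mkseq x n) x.
Proof. by rewrite /approx size_mkseq. Qed.

Lemma take_mkseq T (x : nat -> T) m n : take m (mkseq x n) = mkseq x (minn m n).
Proof. by rewrite /mkseq -map_take take_iota. Qed.

Lemma approx_take T (x : nat -> T) m s : approx s x -> approx (take m s) x.
Proof. by move=> ->; rewrite take_mkseq; exact: approx_mkseq. Qed.

Lemma approx_prefix (T : eqType) (x : nat -> T) s s' :
  prefix s s' -> approx s' x -> approx s x.
Proof.
by move=> /prefixP[r ->] /(@approx_take _ _ (size s)); rewrite take_size_cat.
Qed.

Lemma approx_nth T (x : nat -> T) d s i : approx s x -> i < size s ->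
    nth d s i = x i.
Proof. by move=> -> ; rewrite size_mkseq => h; rewrite nth_mkseq. Qed.

Lemma tends_comp T U V F G (x : nat -> T) (y : nat -> U) (z : nat -> V) :
  tends F x y -> tends G y z -> tends (fun s => G (F s)) x z.
Proof.
move=> [F1 F2] [G1 G2]; split=> [s /F1/G1//|n].
have [m hm] := G2 n; have [k hk] := F2 m.
by exists k => s sx ks; apply: hm; [exact: F1|exact: hk].
Qed.

Lemma tends_eq T U F G (x : nat -> T) (y : nat -> U) :
  (forall s, approx s x -> F s = G s) -> tends G x y -> tends F x y.
Proof.
move=> FG [G1 G2]; split=> [s sx|n]; first by rewrite FG //; exact: G1.
by have [m hm] := G2 n; exists m => s sx; rewrite FG //; exact: hm.
Qed.

(** The state holds the length of the block being read and the blocks completed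
so far, in reverse order. An incomplete last block is dropped by [parse],
because its length may still grow. *)
Definition parse_step (st : nat * seq nat) (b : bool) : nat * seq nat :=
  if b then (st.1.+1, st.2) else (0, st.1 :: st.2).

Definition parse (w : seq bool) : seq nat :=
  rev (foldl parse_step (0, [::]) w).2.

Lemma parse_blocks p n : parse (blocks p n) = mkseq p n.
Proof.
rewrite /parse; suff -> : foldl parse_step (0, [::]) (blocks p n) =
  (0, rev (mkseq p n)).
  by rewrite revK.
elim: n => // n IH; rewrite blocksS foldl_cat IH.
have block k : forall a r, foldl parse_step (a, r) (rcons (nseq k true) false) =
    (0, a + k :: r).
  by elim: k => [|k IHk] a r; rewrite /= ?addn0 // IHk addSnnS.
by rewrite block add0n /mkseq -addn1 iotaD map_cat rev_cat.
Qed.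

Lemma parse_prefix w w' : prefix (parse w) (parse (w ++ w')).
Proof.
rewrite /parse foldl_cat; elim: w' (foldl _ _ w) => [|b w' IH] [a r] /=.
  exact: prefix_refl.
apply: prefix_trans (IH _); rewrite /parse_step; case: b => /=.
  exact: prefix_refl.
by rewrite rev_cons prefix_rcons.
Qed.

Lemma blocks_inscription p n : blocks p n = mkseq (inscription p)
    (size (blocks p n)).
Proof.
apply: (@eq_from_nth _ false); first by rewrite size_mkseq.
by move=> i hi; rewrite nth_mkseq // (inscription_blocks hi).
Qed.

Lemma tends_parse p : tends parse (inscription p) p.
Proof.
split=> [s sp|n].
  apply: (@approx_prefix _ _ _ (mkseq p (size s))); last exact: approx_mkseq.
  rewrite -parse_blocks -(cat_take_drop (size s) (blocks p (size s))).
  suff -> : take (size s) (blocks p (size s)) = s by exact: parse_prefix.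
  rewrite blocks_inscription take_mkseq (minn_idPl (size_blocks _ _)).
  by rewrite [RHS]sp.
exists (size (blocks p n)) => s sp hs.
have := parse_prefix (take (size (blocks p n)) s) (drop (size (blocks p n)) s).
rewrite cat_take_drop; move/size_prefix; apply: leq_trans.
rewrite sp take_mkseq (minn_idPl hs) -blocks_inscription parse_blocks.
by rewrite size_mkseq.
Qed.

Definition bits (us : seq nat) : seq bool :=
  flatten [seq rcons (nseq a true) false | a <- us].

Lemma bits_mkseq p n : bits (mkseq p n) = blocks p n.
Proof. by rewrite /bits /blocks -map_comp. Qed.

Lemma tends_bits (p : baire) : tends bits p (inscription p).
Proof.
split=> [s ->|n]; first by rewrite bits_mkseq /approx {1}blocks_inscription.
exists n => s -> hs; rewrite bits_mkseq; apply: leq_trans (size_blocks _ _).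
by rewrite size_mkseq in hs.
Qed.

Lemma run_local M x x' t : (forall i, i < t -> x i = x' i) ->
  run M x t = run M x' t /\ inpos (run M x t) <= t.
Proof.
elim: t => // t IH h; have [|e le_t] := IH; first by move=> i it; apply: h;
  exact: ltnW.
rewrite /run !iterS -!/(run _ _ _) -e; move: le_t.
case: (run M x t) => s i ws o /= le_t; rewrite h ?ltnS //.
by split=> //; case: (nth Halt M s) => * /=; rewrite ?ltnS // leqW.
Qed.

Lemma run_approx M b x : approx b x -> run M (nth false b) (size b) =
    run M x (size b).
Proof.
by move=> bx; case: (@run_local M (nth false b) x (size b)) => // i;
  exact: approx_nth.
Qed.

(** A prefix of the input determines a prefix of the output, and each symbol of
the output is written after finitely many steps. *)
Lemma tends_sim M p q : outputs M p q ->
  tends (sim M) (inscription p) (inscription q).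
Proof.
move=> Mpq; split=> [b bp|n]; last first.
  have [t ht] := Mpq n; exists t => b bp tb; rewrite /sim (run_approx M bp).
  have := size_prefix (out_prefix M (inscription p) tb); apply: leq_trans.
  by have := congr1 size ht; rewrite size_mkseq size_take_min => <-;
    exact: geq_minr.
rewrite /sim (run_approx M bp); set o := out _.
have [t ht] := Mpq (size o); rewrite /approx -ht.
have [le_bt|/ltnW le_tb] := leqP (size b) t.
  by have /prefixP[r ->] := out_prefix M (inscription p) le_bt;
    rewrite take_size_cat.
have /prefixP[r e] := out_prefix M (inscription p) le_tb.
have := congr1 size ht; rewrite size_mkseq size_take_min -/o => es.
have : size o <= size (out (run M (inscription p) t)) by rewrite -es geq_minr.
rewrite -/o in e; rewrite {1}e size_cat.
rewrite -[leqRHS]addn0 leq_add2l leqn0 size_eq0 => /eqP r0.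
by rewrite e r0 cats0 take_size.
Qed.

Definition evens (us : seq nat) := mkseq (fun i => nth 0 us i.*2) (size us)./2.
Definition odds (us : seq nat) := mkseq (fun i => nth 0 us i.*2.+1)
    (size us)./2.

Definition interleave (us vs : seq nat) : seq nat :=
  mkseq (fun i => if odd i then nth 0 vs i./2 else nth 0 us i./2)
    (if size us < size vs then size us else size vs).*2.

Lemma approx_mkseq_eq T (x y : nat -> T) n :
  (forall i, i < n -> x i = y i) -> approx (mkseq x n) y.
Proof.
move=> h; rewrite /approx size_mkseq; apply/eq_in_map => i.
by rewrite mem_iota add0n => /andP[_]; exact: h.
Qed.

Lemma tends_evens u : tends evens u (bfst u).
Proof.
split=> [s su|n].
  by apply: approx_mkseq_eq => i hi; rewrite (approx_nth _ su) //; lia.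
by exists n.*2 => s su hs; rewrite size_mkseq; lia.
Qed.

Lemma tends_odds u : tends odds u (bsnd u).
Proof.
split=> [s su|n].
  by apply: approx_mkseq_eq => i hi; rewrite (approx_nth _ su) //; lia.
by exists n.*2 => s su hs; rewrite size_mkseq; lia.
Qed.

Lemma tends_behead (h : baire) : tends behead h (btail h).
Proof.
split=> [s sh|n]; last by exists n.+1 => s sh hs; rewrite size_behead; lia.
by rewrite sh; case: (size s) => //= n;
  rewrite /approx size_map size_iota (iotaDl 1 0) -map_comp.
Qed.

Lemma tends_interleave T F G (x : nat -> T) p r :
  tends F x p -> tends G x r ->
  tends (fun s => interleave (F s) (G s)) x (bpair p r).
Proof.
move=> [F1 F2] [G1 G2]; split=> [s sx|n].
  apply: approx_mkseq_eq => i; rewrite /bpair => hi.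
  have [h1 h2] : i./2 < size (F s) /\ i./2 < size (G s).
    by case: (ltnP (size (F s)) (size (G s))) hi => ? hi; lia.
  by rewrite (approx_nth _ (F1 s sx)) // (approx_nth _ (G1 s sx)).
have [k hk] := F2 n; have [l hl] := G2 n; exists (k + l) => s sx hs.
have := hk s sx; have := hl s sx; rewrite size_mkseq.
by case: (ltnP (size (F s)) (size (G s))); lia.
Qed.

(** The universal computation. From a prefix [w] of the inscription of [<p, r>],
this finds the prefix [h] of the output [nq] that the machine [M] has produced
on [p], runs the program with index [n] on what is known of [<q, r>], and
returns the numbers that this program has produced. *)
Definition simulated_value (M : program) (w : seq bool) : seq nat :=
  let us := parse w in
  let h := parse (sim M (bits (evens us))) in
  parse (sim (program_of (head 0 h)) (bits (interleave (behead h) (odds us)))).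

(** Until the first block of the output of [M] is complete, the index is not
known, but then the simulated program gets no input and makes no step, so it
does not matter which program it is. *)
Lemma tends_value M p r h q : outputs M p h ->
  outputs (program_of (h 0)) (bpair (btail h) r) q ->
  tends (simulated_value M) (inscription (bpair p r)) q.
Proof.
move=> Mh Pq; have [e1 e2] := bpairK p r.
have tu := tends_parse (bpair p r).
have th : tends (fun w => parse (sim M (bits (evens (parse w)))))
    (inscription (bpair p r)) h.
  have := tends_comp tu (@tends_evens _); rewrite e1 => t1.
  apply: tends_comp (@tends_parse h); apply: tends_comp (tends_sim Mh).
  exact: tends_comp t1 (@tends_bits p).
pose G w := parse (sim (program_of (h 0)) (bits (interleave
  (behead (parse (sim M (bits (evens (parse w)))))) (odds (parse w))))).
apply: (@tends_eq _ _ _ G) => [w wu|]; last first.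
  apply: tends_comp (@tends_parse q); apply: tends_comp (tends_sim Pq).
  apply: tends_comp (@tends_bits _); apply: tends_interleave.
    exact: tends_comp th (@tends_behead _).
  by have := tends_comp tu (@tends_odds _); rewrite e2.
rewrite /simulated_value /G; have := th.1 w wu.
case: (parse (sim M _)) => [|n h'] ah /=.
  by rewrite /interleave /=; case: (odds _).
by have <- : n = h 0 := approx_nth 0 ah (ltn0Sn _).
Qed.

Lemma eff_parse S {cS : coded S} (w : S -> seq bool) : effective w ->
  effective (fun x => parse (w x)).
Proof.
move=> hw; apply: eff_rev; apply: eff_snd; apply: eff_foldl; effs.
by apply: eff_if; effs.
Qed.

Lemma eff_bits S {cS : coded S} (l : S -> seq nat) : effective l ->
  effective (fun x => bits (l x)).
Proof.
move=> hl; apply: eff_flatten; apply: eff_map => //; effl.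
by apply: eff_nseq; effs.
Qed.

Lemma eff_simulated_value M : effective (simulated_value M).
Proof.
have hu := eff_parse eff_id.
have hu1 : effective (fun y : seq bool * nat => parse y.1).
  by apply: (eff_comp (f := fst) hu); effs.
have he : effective (fun w => evens (parse w)) by apply: eff_mkseq; effl.
have ho : effective (fun w => odds (parse w)) by apply: eff_mkseq; effl.
pose h w := parse (sim M (bits (evens (parse w)))).
have hh : effective h.
  by apply: eff_parse; apply: eff_sim; [effs|exact: eff_bits].
have hi : effective (fun w => interleave (behead (h w)) (odds (parse w))).
  apply: eff_mkseq; last first.
    apply: eff_if; effl.
      by apply: (eff_comp (f := fst) ho); effs.
    by apply: (eff_comp (f := fst) hh); effs.
  apply: eff_double; apply: eff_if; effl.
  by apply: eff_leq; effl.
apply: eff_parse; apply: eff_sim; last exact: eff_bits.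
by apply: (eff_comp eff_program_of); effl.
Qed.

(** * Searching the prefixes of the input *)

Lemma the_Some T (P : set T) x : the P = Some x -> P x.
Proof.
rewrite /the; case: pselect => // h [<-]; exact: projT2 (cid h).
Qed.

Lemma Some_the T (P : set T) x : P x -> (forall y, P y -> x = y) -> the P =
    Some x.
Proof.
move=> Px uniq; rewrite /the; case: pselect => [h|[]]; last by exists x.
by rewrite -(uniq _ (projT2 (cid h))).
Qed.

Lemma machine_fun_Some M p q : machine_fun M p = Some q <-> outputs M p q.
Proof.
split=> h; first exact: (the_Some h).
by apply: (Some_the h) => q' h'; exact: outputs_unique h h'.
Qed.

Lemma outputs_blocks M p q : (forall n, exists t,
    out (run M (inscription p) t) = blocks q n) -> outputs M p q.
Proof.
move=> h n; have [t ht] := h n; exists t.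
by rewrite ht blocks_inscription take_mkseq (minn_idPl (size_blocks _ _)).
Qed.

(** [A] and [B] append the next input bit, 0 or 1, to the stored prefix, and [C]
evaluates the property of that prefix into register 1, which lives on tape 3.
Then [10], the block of the number 1, is written, and the search goes on if the
property failed. Otherwise [0], the block of the number 0, is written forever.
*)
Definition search_code (A B C : program) : program :=
  let a := size A in let b := size B in let c := size C in
  [:: IfInput (a + 2)] ++ A ++ goto (a + b + 2) ++ B ++ [:: MoveInput] ++ C ++
  [:: Output true; Output false] ++ dec_code 3 0 ++
  [:: Output false] ++ goto (a + b + c + 8).

Lemma search_code_at A B C :
  let M := search_code A B C in
  let a := size A in let b := size B in let c := size C in
  [/\ code_at M 0 [:: IfInput (a + 2)], code_at M 1 A,
      code_at M (a + 1) (goto (a + b + 2)), code_at M (a + 2) B &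
      code_at M (a + b + 2) [:: MoveInput]] /\
  [/\ code_at M (a + b + 3) C,
      code_at M (a + b + c + 3) [:: Output true; Output false],
      code_at M (a + b + c + 5) (dec_code 3 0),
      code_at M (a + b + c + 8) [:: Output false] &
      code_at M (a + b + c + 9) (goto (a + b + c + 8))].
Proof.
have at_pos M n n' p : code_at M n p -> n = n' -> code_at M n' p by move=> ? <-.
have : code_at (search_code A B C) 0 (search_code A B C) by [].
rewrite {2}/search_code.
move=> /code_at_cat[h1] /code_at_cat[h2] /code_at_cat[h3] /code_at_cat[h4].
move=> /code_at_cat[h5] /code_at_cat[h6] /code_at_cat[h7] /code_at_cat[h8].
move=> /code_at_cat[h9 h10].
split; split; [exact: h1|exact: h2|apply: at_pos h3 _|apply: at_pos h4 _
  |apply: at_pos h5 _|apply: at_pos h6 _|apply: at_pos h7 _|apply: at_pos h8 _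
  |apply: at_pos h9 _|apply: at_pos h10 _]; rewrite /=; lia.
Qed.

(** Writing a 1 after each failure makes the output infinite even if the search
never succeeds. *)
Lemma search_machine (P : seq bool -> bool) : effective P ->
  exists M, forall p, exists q, machine_fun M p = Some q /\
    (deltaS q <-> exists m, P (mkseq (inscription p) m.+1)).
Proof.
move=> hP.
(* The prefix is stored in reverse order, so that appending a bit is [cons]. *)
have [gF /(_ 0)[cF hF] eF] : effective (fun w : seq bool => false :: w) by effs.
have [gT /(_ 0)[cT hT] eT] : effective (fun w : seq bool => true :: w) by effs.
have [gP /(_ 1)[cP hPP] eP] : effective (fun w : seq bool => P (rev w)).
  by apply: (eff_comp hP); apply: eff_rev; effs.
pose A := compile cF 0 1; pose B := compile cT 0 (size A + 2).
pose C := compile (Seq (Copy 0 1) cP) 0 (size A + size B + 3).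
pose M := search_code A B C; exists M => p; set x := inscription p.
have [[h1 h2 h3 h4 h5] [h6 h7 h8 h9 h10]] := search_code_at A B C.
rewrite -/M in h1 h2 h3 h4 h5 h6 h7 h8 h9 h10.
pose found n := has (fun j => P (mkseq x j.+1)) (iota 0 n).
pose q : baire := fun n => if found n then 0 else 1.
exists q; split; last first.
  rewrite /deltaS; split=> [/asboolP[n]|[m Pm]].
    by rewrite /q; case: ifP => // /hasP[j _ Pj] _; exists j.
  apply/asboolP; exists m.+1; rewrite /q /found -addn1 iotaD has_cat /= Pm.
  by rewrite orbT.
apply/machine_fun_Some/outputs_blocks.
pose e := fun _ : nat => 0.
pose final := size A + size B + size C + 8.
have e0 : forall j, 0 <= j -> e j = 0 by [].
(* The situation after [n] blocks of output. *)
have key n : exists s ws i, [/\ holds (tapes s e) ws,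
    reach M x (Config 0 0 [::] [::])
      (Config (if found n then final else 0) i ws (blocks q n)) &
    ~~ found n -> i = n /\ s 0 = encode (rev (mkseq x n))]; last first.
  move=> n; have [s [ws [i [_ [t ht] _]]]] := key n.
  by exists t; rewrite /run ht.
elim: n => [|n [s [ws [i [hs hr hn]]]]].
  exists e, [::], 0; split=> //; last exact: reach_refl.
  move=> t; rewrite nth_nil /tapes; case: ifP => _; exact: unary_blank.
have foundS : found n.+1 = found n || P (mkseq x n.+1).
  by rewrite /found -addn1 iotaD has_cat /= orbF add0n addn1.
rewrite blocksS foundS; case: (boolP (found n)) hr hn => /= [fn|nfn] hr hn.
  have -> : q n = 0 by rewrite /q fn.
  exists s, ws, i; split=> //; apply: reach_trans hr _.
  apply: reach_instr; first by rewrite -[final]addn0; apply: h9.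
  have h10' : code_at M final.+1 (goto final).
    by rewrite /final -addnS.
  by rewrite cats1; apply: run_goto h10' hs (reach_refl _ _ _).
have [ei es] := hn isT; rewrite {}ei in hr => {hn}.
have [s1 [ws1 [hs1 es1 r1]]] : exists s1 ws1, [/\ holds (tapes s1 e) ws1,
    s1 0 = encode (rev (mkseq x n.+1)) &
    reach M x (Config 0 n ws (blocks q n))
      (Config (size A + size B + 2) n ws1 (blocks q n))].
  have eS : rev (mkseq x n.+1) = x n :: rev (mkseq x n).
    by rewrite /mkseq -addn1 iotaD map_cat rev_cat.
  rewrite eS; case: (boolP (x n)) => xn.
    have [ws1 [hs1 r1]] := run_compile x n (blocks q n) h4 hs e0.
    exists (sem cT s), ws1; split=> //; first by rewrite (hT s).1 es eT.
    apply: reach_instr; first exact: (h1 0).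
    rewrite /= -/x xn; move: r1; rewrite -/B.
    by congr (reach _ _ _ (Config _ _ _ _)); lia.
  have [ws1 [hs1 r1]] := run_compile x n (blocks q n) h2 hs e0.
  exists (sem cF s), ws1; split=> //; first by rewrite (hF s).1 es eF.
  apply: reach_instr; first exact: (h1 0).
  rewrite /= (negbTE xn); apply: reach_trans r1 _.
  by move: h3; rewrite addnC => h3; apply: run_goto h3 hs1 (reach_refl _ _ _).
have [ws2 [hs2 r2]] := run_compile x n.+1 (blocks q n) h6 hs1 e0.
have [_ below] := hPP (upd s1 1 (s1 0)).
set s2 := sem _ s1 in hs2.
have s20 : s2 0 = s1 0 by rewrite /s2 semSeqCopy // below.
have s21 : s2 1 = P (mkseq x n.+1).
  by rewrite /s2 semSeqCopy // (hPP _).1 updE es1 eP revK.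
have [ws3 [hs3 r3]] :=
  run_dec x n.+1 (rcons (rcons (blocks q n) true) false) h8 hs2.
have -> : q n = 1 by rewrite /q (negbTE nfn).
have value3 : tapes s2 e 3 = P (mkseq x n.+1).
  by rewrite -s21; exact: (tapes_reg s2 e 1).
rewrite value3 (tapes_upd_reg s2 e 1) in hs3 r3.
exists (upd s2 1 (P (mkseq x n.+1)).-1), ws3, n.+1; split=> //; last first.
  by rewrite /upd /= s20 es1.
apply: reach_trans hr _; apply: reach_trans r1 _.
apply: reach_instr; first by rewrite -[_ + 2]addn0; apply: h5.
rewrite /= -addnS; apply: reach_trans r2 _.
rewrite -/C addnAC.
set l := size A + size B + size C in h7 h8 h9 h10 final r3 *.
apply: reach_instr; first by rewrite -[l + 3]addn0; apply: h7.
apply: reach_instr; first by rewrite -[_.+1]addn1; apply: h7.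
rewrite /= -!addnS; apply: reach_trans r3 _.
rewrite -cats1 -cats1 -catA; case: (P _) => /=; last exact: reach_refl.
by rewrite -addnA; exact: reach_refl.
Qed.

(** * Continuity of computable functions, and prepending an index *)

Lemma nbhs_agree (p : baire) m :
  nbhs p [set p' : baire | forall i, i < m -> p i = p' i]%classic.
Proof.
elim: m => [|m IH]; first by apply: filterS (filterT : nbhs p setT) => p' _ i.
have hm : nbhs p [set p' : baire | p' m = p m]%classic.
  exact: (@proj_continuous _ (fun _ : nat =>
    nat) m p [set p m]%classic (discrete_set1 _)).
apply: filterS (filterI IH hm) => p' [h e] i.
by rewrite ltnS leq_eqVlt => /predU1P[->|/h].
Qed.

(** Continuity for the product topology is checked coordinatewise, and each
coordinate is discrete. *)
Lemma pcontinuous_local (F : baire -> option baire) :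
  (forall p q n, F p = Some q -> exists m, forall p' q', F p' = Some q' ->
    (forall i, i < m -> p i = p' i) -> q n = q' n) -> pcontinuous F.
Proof.
move=> h; apply/subspace_continuousP => p Fp.
rewrite /from_subspace; set f := (fun p => odflt _ _).
apply/cvg_sup => n U.
have /= -> := @nbhsE (initial_topology (fun f : baire => f n)) (f p).
case=> B [[C oC <-] Cq] /filterS; apply.
have [q e] : exists q, F p = Some q.
  by move: Fp; rewrite /pdom /=; case: (F p) => // q; exists q.
rewrite /f /= e in Cq.
have [m hm] := h p q n e.
suff : nbhs p [set p' | pdom F p' -> C (f p' n)]%classic by [].
apply: filterS (nbhs_agree p m) => p' agree; rewrite /mkset /f /pdom /=.
case e' : (F p') => [q'|] //= _.
by rewrite -(hm _ _ e' agree).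
Qed.

(** An output number is written after finitely many steps, which depend on
finitely many blocks of the input only. *)
Lemma machine_fun_local M p q n : machine_fun M p = Some q ->
  exists m, forall p' q', machine_fun M p' = Some q' ->
    (forall i, i < m -> p i = p' i) -> q n = q' n.
Proof.
move=> /machine_fun_Some Mpq.
have [F1 F2] := tends_comp (tends_sim Mpq) (@tends_parse q).
have [k hk] := F2 n.+1; exists k => p' q' /machine_fun_Some Mpq' agree.
have [G1 _] := tends_comp (tends_sim Mpq') (@tends_parse q').
have eb : blocks p k = blocks p' k.
  rewrite /blocks; congr flatten; apply/eq_in_map => i.
  by rewrite mem_iota => /andP[_ ik]; rewrite agree.
have ap u : approx (blocks u k) (inscription u).
  by rewrite /approx -blocks_inscription.
have hs := hk _ (ap p) (size_blocks p k).
rewrite -(approx_nth 0 (F1 _ (ap p)) hs).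
by rewrite eb in hs *; rewrite (approx_nth 0 (G1 _ (ap p')) hs).
Qed.

Definition bcons (n : nat) (p : baire) : baire :=
  fun i => if i is j.+1 then p j else n.

(** The machine writes [n] marks and a separator and then copies its input. *)
Lemma computable_bcons n : computable (fun p => Some (bcons n p)).
Proof.
pose loop_code := [::
  IfInput (n + 5); Output false; MoveInput; IfWork 0 0 (n + 1);
  Output true; MoveInput; IfWork 0 0 (n + 1)].
pose M : program := nseq n (Output true) ++ Output false :: loop_code.
exists M; apply/funext => p; apply/esym/machine_fun_Some/outputs_blocks.
set x := inscription p.
have instr k : nth Halt M (n + k) = nth Halt (Output false :: loop_code) k.
  by rewrite nth_cat size_nseq ltnNge leq_addr /= addKn.
have start : reach M x (Config 0 0 [::] [::])
    (Config (n + 1) 0 [::] (rcons (nseq n true) false)).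
  have ones k : k <= n ->
      reach M x (Config 0 0 [::] [::]) (Config k 0 [::] (nseq k true)).
    elim: k => [_|k IH kn]; first exact: reach_refl.
    apply: reach_trans (IH (ltnW kn)) _; apply: reach_instr.
      by rewrite nth_cat size_nseq kn nth_nseq kn.
    have -> : nseq k.+1 true = rcons (nseq k true) true by
      rewrite -cats1 cat_nseq /ncons -iterSr.
    exact: reach_refl.
  have instr0 := instr 0; rewrite addn0 in instr0.
  apply: reach_trans (ones n (leqnn n)) _; apply: (reach_instr instr0).
  by rewrite /= addn1; exact: reach_refl.
have copy k : reach M x (Config 0 0 [::] [::])
    (Config (n + 1) k [::] (rcons (nseq n true) false ++ mkseq x k)).
  elim: k => [|k IH]; first by rewrite cats0.
  apply: reach_trans IH _.
  have -> : mkseq x k.+1 = rcons (mkseq x k) (x k).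
    by rewrite /mkseq -addn1 iotaD map_cat cats1.
  rewrite -rcons_cat; apply: reach_instr; first exact: instr.
  case: (x k) => /=.
    do 3 (apply: reach_instr; first by rewrite -?addnS; exact: instr).
    exact: reach_refl.
  do 3 (apply: reach_instr; first by rewrite -?addnS; exact: instr).
  exact: reach_refl.
case=> [|k]; first by exists 0.
have [t ht] := copy (size (blocks p k)); exists t.
rewrite /run ht /= -blocks_inscription /blocks -[k.+1]add1n iotaD /=.
by rewrite (iotaDl 1 0) -map_comp.
Qed.

(** * The two reductions *)

Section Weihrauch.
Variables (X Y : namedSpace) (A : set baire) (f : X -> set Y).
Local Notation CA := (@closed_choice (subspace_rep A)).

Lemma delta_subspace p (a : set_type A) :
  delta (subspace_named A) p = Some a <-> val a = p.
Proof.
split; first by rewrite /=; case: insubP => // u _ <- [->].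
by move=> <-; rewrite /= valK.
Qed.

(** The advice accepted for [p] is a closed set, and an index of [F2] followed
by [p] is literally a name of it, because a name in the function space
representation is an index together with a parameter. *)
Lemma nondet_weihrauch : nondet_computable A f -> weihrauch_le f CA.
Proof.
move=> [F1 [F2 [cF1 [M2 eF2] hF]]].
have [n en] := program_of_surj M2.
exists F1, (fun p => Some (bcons n p)); split=> //; first
  exact: computable_bcons.
move=> G hG p x px fx; have [total [r [s [Ar Fr sr]]] sound] := hF p x px fx.
pose B : set (subspace_rep A) := fun a : set_type A =>
  exists s, F2 (bpair p (val a)) = Some s /\ deltaS s = false.
have realB : realizes (fun r => F2 (bpair p r)) (single (chi (~` B)%classic)).
  move=> r' a /delta_subspace <- _.
  have := total _ (set_mem (valP a)); rewrite /pdom /=.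
  case e : (F2 _) => [s'|] // _; exists s', (deltaS s'); split=> //.
  rewrite /single /chi /=; apply/esym; case e' : (deltaS s').
    by apply/asboolP => -[s'' []]; rewrite e => -[<-]; rewrite e'.
  by apply/asboolP => nB; apply: nB; exists s'.
have closedB : closed_in B.
  exists (fun r => F2 (bpair p r)); split=> //.
  apply: pcontinuous_local => r1 q k; rewrite eF2 => e1.
  have [m hm] := machine_fun_local k e1; exists m => r2 q2 e2 agree.
  apply: hm e2 _ => i im; rewrite /bpair; case: ifP => // _.
  by apply: agree; apply: leq_ltn_trans im; rewrite -divn2; exact: leq_div.
pose B' : closed_sets (subspace_rep A) := exist _ B closedB.
have nameB' : closed_name (bcons n p) B'.
  move=> r' a ra fa; have [q [y [Fq dq by_]]] := realB r' a ra fa.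
  by exists q, y; split=> //; rewrite /Phi /= en -eF2.
have nameB : delta (closed_sets (subspace_rep A)) (bcons n p) = Some B'.
  by apply: (Some_the nameB') => B'' nameB'';
    exact: closed_name_unique nameB' nameB''.
have [|q [y [Gq /delta_subspace ey [s' [Fs' s'0]]]]] := hG _ _ nameB.
  by exists (SigSub (mem_set Ar)), s.
by rewrite /= Gq /= -ey; apply: sound Fs' s'0; exact: set_mem (valP y).
Qed.

(** The hypothesis speaks of all realizers of closed choice. A realizer that is
undefined outside of the domain of closed choice shows that [H p] names a
nonempty closed set. Redirecting it at the single argument [H p] to a point [r]
of that set shows that [K <p, r>] names a correct result. *)
Lemma weihrauch_nondet : weihrauch_le f CA -> nondet_computable A f.
Proof.
move=> [K [H [cK [MH eH] hKH]]].
have eP : effective (fun w => 0 \in simulated_value MH w).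
  by apply: eff_mem0; exact: eff_simulated_value.
have [M2 hM2] := search_machine eP.
exists K, (machine_fun M2); split=> //; first by exists M2.
move=> p x px fx.
(* A realizer of closed choice that is undefined wherever it may be. *)
pose choose p' : option baire :=
  if the (@closed_name (subspace_rep A) p') is Some B then
    if pselect (exists a, sval B a) is left h then Some (val (projT1 (cid h)))
    else None
  else None.
have choose_real : realizes choose CA.
  move=> p' B eB [a Ba]; rewrite /choose; move: eB; rewrite /= => ->.
  case: pselect => [h|[]]; last by exists a.
  exists (val (projT1 (cid h))), (projT1 (cid h)); split=> //.
    exact/delta_subspace.
  exact: projT2 (cid h).
have [h [B [Hp eB [a Ba]]]] : exists h B, [/\ H p = Some h,
    the (@closed_name (subspace_rep A) h) = Some B & exists a, sval B a].
  have [q [y [+ _ _]]] := hKH _ choose_real p x px fx.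
  case: (H p) => //= h; rewrite /choose; case e : (the _) => [B|//].
  by case: pselect => // hB _; exists h, B.
have nameB := the_Some eB.
have value (b : set_type A) : exists2 q,
    Phi (h 0) (bpair (btail h) (val b)) = Some q & deltaS q = `[< ~ sval B b >].
  have db : delta (subspace_rep A) (val b) = Some b by exact/delta_subspace.
  have fb : mdom (single (chi (~` sval B)%classic)) b.
    by exists (chi (~` sval B)%classic b).
  by have [q [_ [Fq [<-] e]]] := nameB (val b) b db fb; exists q.
have F2E (b : set_type A) s : machine_fun M2 (bpair p (val b)) = Some s ->
    deltaS s = `[< ~ sval B b >].
  have [q Fq <-] := value b; have [s' [-> hs']] := hM2 (bpair p (val b)).
  move=> [<-].
  have [t1 t2] : tends (simulated_value MH) (inscription (bpair p (val b))) q.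
    apply: (@tends_value MH p (val b) h q); apply/machine_fun_Some => //.
    by rewrite -eH.
  apply/idP/idP => [/hs'[m]|/asboolP[k qk]].
    have := t1 _ (approx_mkseq _ m.+1).
    set w := simulated_value _ _ => aw /(nthP 0)[i iw e].
    by apply/asboolP; exists i; rewrite -(approx_nth 0 aw iw).
  apply/hs'; have [m hm] := t2 k.+1; exists m.
  have aw := approx_mkseq (inscription (bpair p (val b))) m.+1.
  have kw := hm _ aw (leq_trans (leqnSn m) _); rewrite size_mkseq leqnn in kw.
  rewrite -qk -(approx_nth 0 (t1 _ aw) (kw isT)); exact: mem_nth (kw isT).
split.
- by move=> r _; have [s [e _]] := hM2 (bpair p r); rewrite /pdom /= e.
- have [s [e _]] := hM2 (bpair p (val a)); exists (val a), s; split=> //.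
    exact: set_mem (valP a).
  by rewrite (F2E _ _ e); apply/asboolPn.
- move=> r s Ar Fs s0.
  pose b : set_type A := SigSub (mem_set Ar).
  have Bb : sval B b.
    apply: contrapT => nBb; move: s0; rewrite (F2E b _ Fs).
    by move/negP; apply; apply/asboolP.
  pose G p' := if pselect (p' = h) then Some r else choose p'.
  have G_real : realizes G CA.
    move=> p' B1 eB1 B1a; rewrite /G; case: pselect => [e|ne] /=; last first.
      exact: choose_real eB1 B1a.
    move: eB1; rewrite e /= eB => /Some_inj <-; exists r, b; split=> //.
    exact/delta_subspace.
  have := hKH _ G_real p x px fx; rewrite Hp /=.
  by rewrite /G; case: pselect.
Qed.

End Weihrauch.

Theorem theorem7p2 (X Y : repSpace) (A : set baire) (f : X -> set Y) :
  weihrauch_le f (@closed_choice (subspace_rep A)) <-> nondet_computable A f.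
Proof. by split; [exact: weihrauch_nondet|exact: nondet_weihrauch]. Qed.
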